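(* Let $K$ be a number field of degree $n\ge2$ and let $i,j\ge1$ be integers with $i+j<n$. The following are equivalent: (1) $\mathrm{Spe}(\mathcal S(K))\subseteq\{\mathbf x\in\mathbb R^{n-1}:x_{i+j}\le x_i+x_j\}$; (2) there exists a constant $c_K>0$ depending only on $K$ such that $\lambda_{i+j}(\mathcal O)\le c_K\lambda_i(\mathcal O)\lambda_j(\mathcal O)$ for all $\mathcal O\in\mathcal S(K)$; (3) $\lambda_{i+j}(\mathcal O)\le\sqrt n\,\lambda_i(\mathcal O)\lambda_j(\mathcal O)$ for all $\mathcal O\in\mathcal S(K)$; (4) $K$ has no subfield of degree $m$ such that $(i\bmod m)+(j\bmod m)\ne(i+j)\bmod m$.
   Context: $|x|=\sqrt{\frac1n\sum_m|\sigma_m(x)|^2}$ over the complex embeddings $\sigma_m$ of $K$; for a full rank lattice $\Lambda$, $\lambda_i(\Lambda)=\min\{r>0:\dim_{\mathbb Q}\mathrm{Span}_{\mathbb Q}\{x\in\Lambda:|x|\le r\}\ge i+1\}$. $\mathcal S(K)$ is the set of isomorphism classes of orders in $K$. $\Delta_{\mathcal O}$ is the absolute discriminant. For an infinite set $\mathcal S$ of isomorphism classes of orders, the Minkowski type $\mathbf x_{\mathcal S}$ is the limit (if it exists) of $(\log_{\Delta}\lambda_1(\mathcal O),\dots,\log_\Delta\lambda_{n-1}(\mathcal O))$ as $\mathcal O$ ranges over $\mathcal S$ ($\Delta_{\mathcal O}\to\infty$), and $\mathrm{Spe}(\mathcal S)$ is the set of Minkowski types of infinite subsets of $\mathcal S$.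 $a\bmod b$ denotes the remainder. *)

(* Defs.v *)
From HB Require Import structures.
From mathcomp Require Import all_boot all_order all_algebra all_field.
From mathcomp Require Import all_classical all_reals all_analysis.
From mathcomp Require Import complex.

Set Implicit Arguments.
Unset Strict Implicit.
Unset Printing Implicit Defensive.

Import Order.TTheory GRing.Theory Num.Theory.
Import numFieldNormedType.Exports.

Local Open Scope classical_set_scope.
Local Open Scope ring_scope.

(* A number field is a [K : fieldExtType rat]; its degree is [\dim {:K}].     *)

Section Orders.
Variable K : fieldExtType rat.
Implicit Types L O : set K.

Definition is_Zbasis L (b : (\dim {:K}).-tuple K) : Prop :=
  basis_of {:K} b /\ L = [set x | inIntSpan b x].

Definition full_rank_lattice L : Prop := exists b, is_Zbasis L b.

Definition is_order O : Prop :=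
  [/\ full_rank_lattice O, O 1 & forall x y, O x -> O y -> O (x * y)].

(* Unital ring isomorphism; the values of [f] outside [O] are irrelevant.     *)
Definition order_iso O O' : Prop :=
  exists f : K -> K,
    [/\ set_bij O O' f, f 1 = 1,
        forall x y, O x -> O y -> f (x + y) = f x + f y &
        forall x y, O x -> O y -> f (x * y) = f x * f y].

Definition iso_class O : set (set K) :=
  [set O' | is_order O' /\ order_iso O O'].

Definition order_classes : set (set (set K)) :=
  [set iso_class O | O in is_order].

(* Trace of K / Q: the trace of the Q-linear map "multiplication by x".       *)
Definition trK (x : K) : rat :=
  \tr (passmx.mxof (vbasis {:K}) (vbasis {:K}) (amulr x)).

Definition basis_disc (b : (\dim {:K}).-tuple K) : rat :=
  \det (\matrix_(i, j) trK (tnth b i * tnth b j)).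

(* The discriminant does not depend on the Z-basis, so any one may be chosen. *)
Definition abs_disc L : rat :=
  `|basis_disc (xget [tuple of nseq _ 0] (is_Zbasis L))|.

(* Junk value 0%VS if no least subspace existed; [QspanP] rules this out.     *)
Definition Qspan (A : set K) : {vspace K} :=
  xget 0%VS [set V : {vspace K} | (forall x, A x -> x \in V) /\
    forall W : {vspace K}, (forall x, A x -> x \in W) -> (V <= W)%VS].

Lemma QspanP (A : set K) :
  (forall x, A x -> x \in Qspan A) /\
  forall W : {vspace K}, (forall x, A x -> x \in W) -> (Qspan A <= W)%VS.
Proof.
rewrite /Qspan; case: xgetP => [V _ // | noV]; exfalso.
pose P (V : {vspace K}) := forall x, A x -> x \in V.
suff step k : forall V, P V -> (\dim V <= k)%N -> False.
  by apply: (step (\dim {:K}) fullv) => // x _; rewrite memvf.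
elim: k => [|k IH] V PV dV; apply: (noV V); split => // W PW.
  by move: dV; rewrite leqn0 dimv_eq0 => /eqP ->; rewrite sub0v.
have PI : P (V :&: W)%VS by move=> x Ax; rewrite memv_cap PV ?PW.
have [/IH|lt_k] := leqP (\dim (V :&: W)%VS) k; first by case/(_ PI).
have /eqP <- : (V :&: W == V)%VS by rewrite eqEdim capvSl (leq_trans dV).
exact: capvSr.
Qed.

End Orders.

Section Minima.
Variables (R : realType) (K : fieldExtType rat).
Implicit Types (L O : set K) (S : set (set (set K))).

Definition embeddings : set (K -> R[i]) :=
  range (fun s : {rmorphism K -> R[i]} => s : K -> R[i]).

Definition Knorm (x : K) : R :=
  Num.sqrt ((\dim {:K})%:R^-1 *
            \sum_(s \in embeddings) complex.Re (`|s x| ^+ 2)).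

(* Defaults to 0 if the minimum is not attained; the sets in [succ_min] have a *)
(* least element because a lattice has finitely many vectors of norm <= r.    *)
Definition minimum (A : set R) : R := xget 0 (A `&` lbound A).

Definition succ_min L (i : nat) : R :=
  minimum [set r | 0 < r /\
    (i.+1 <= \dim (Qspan [set x | L x /\ (Knorm x <= r)%R]))%N].

Definition log_disc O (r : R) : R := ln r / ln (ratr (abs_disc O)).

(* Column k (from 0) holds log_Delta (lambda_(k+1)).                          *)
Definition log_minima O : 'rV[R]_(\dim {:K}).-1 :=
  \row_(k < (\dim {:K}).-1) log_disc O (succ_min O k.+1).

(* 1-based coordinates x_1, ..., x_m of a vector of R^m; 0 out of range.      *)
Definition crd m (x : 'rV[R]_m) (i : nat) : R :=
  if i is k.+1 then oapp (x 0) 0 (insub k : option 'I_m) else 0.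

(* The orders whose class is in S, with Delta tending to infinity. This is a  *)
(* proper filter for infinite S: finitely many orders have bounded Delta.     *)
Definition disc_pinfty S : set_system (set K) :=
  within (\bigcup_(C in S) C)
    (filter_from [set: R] (fun N => [set O | N < ratr (abs_disc O)])).

Definition minkowski_type S (x : 'rV[R]_(\dim {:K}).-1) : Prop :=
  log_minima O @[O --> disc_pinfty S] --> x.

Definition Spe S : set 'rV[R]_(\dim {:K}).-1 :=
  [set x | exists S', [/\ S' `<=` S, infinite_set S' & minkowski_type S' x]].

End Minima.

(* Main.v *)
From HB Require Import structures.
Require Import Defs.
From mathcomp Require Import all_boot all_order all_algebra all_field.
From mathcomp Require Import all_classical all_reals all_analysis.
From mathcomp Require Import complex lra.

Set Implicit Arguments.
Unset Strict Implicit.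
Unset Printing Implicit Defensive.

Import Order.TTheory GRing.Theory Num.Theory.
Import numFieldNormedType.Exports ComplexField.Normc.

Local Open Scope classical_set_scope.
Local Open Scope ring_scope.

(** The successive minima satisfy [|x y| <= sqrt n |x| |y|].  If [V] and [W] are
    the spans of the elements of an order of norm at most [lambda_i] and
    [lambda_j], of dimensions at least [i + 1] and [j + 1], then [V W] has
    dimension at least [dim V F + dim W F - dim F] for its stabiliser [F], by the
    linear version of Kneser's theorem; the divisibility of all these dimensions
    by [dim F] and the hypothesis on remainders give [dim V W > i + j], hence (3).

    (2) gives (1) by taking logarithms; this needs that the discriminants of
    infinitely many classes of orders are unbounded: every order lies in the
    trace dual of a fixed order, with an index controlled by its discriminant.

    Conversely, let [F] be a subfield of degree [m] where the remainders do not
    add up, and write [K = F(a)].  The orders spanned, up to a fixed denominator,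
    by [N^k a^k w] with [w] in a basis of [F] have [lambda_t] of the order of
    [N^(t / m)].  As [(i + j) / m = i / m + j / m + 1] (integer quotients), their
    Minkowski type violates (1). *)

(** * The linear Kneser theorem *)

(** Pigeonhole on a line: if [x] in [A] is outside [U] and [y] is in [U], all points [x + t y] with
    [y] in [A] avoid [U]. With more values of [t] than remaining subspaces, two points fall into the
    same [W], which then contains [y]. So the remaining subspaces already cover [A]. *)
Lemma subspace_of_cover (vT : vectType rat) (A : {vspace vT})
    (s : seq {vspace vT}) :
  (forall x, x \in A -> has (fun U : {vspace vT} => x \in U) s) ->
  has (fun U : {vspace vT} => (A <= U)%VS) s.
Proof.
elim: s => [|U s IH] cov; first by have := cov 0 (mem0v _).
rewrite /=; case: (boolP (A <= U)%VS) => //= /subvPn[x Ax Ux].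
apply: IH => y Ay.
have /= := cov y Ay; case: (boolP (y \in U)) => //= Uy _.
have covt (t : 'I_(size s).+1) : has (fun U : {vspace vT} => x + t%:R *: y \in
  U) s.
  have /= := cov (x + t%:R *: y) (rpredD Ax (rpredZ _ Ay)).
  case: (boolP (_ \in U)) => //= xyU.
  by have := rpredB xyU (rpredZ t%:R Uy); rewrite addrK (negPf Ux).
pose f t := Ordinal (etrans (esym (has_find _ _)) (covt t)).
have [injf|/injectivePn[t [t' ntt' /(congr1 val) /= eqf]]] :=
  boolP (injectiveb f).
  by have := leq_card f (elimT (injectiveP f) injf); rewrite !card_ord ltnn.
have := nth_find 0%VS (covt t); have := nth_find 0%VS (covt t').
rewrite -eqf; set W := nth _ _ _ => Wt' Wt.
have Ws : W \in s by rewrite mem_nth // -has_find.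
apply/hasP; exists W => //.
have := rpredB Wt Wt'; rewrite opprD addrACA subrr add0r -scalerBl.
rewrite rpredZeq => /orP[|//]; rewrite subr_eq0 eqr_nat.
by move=> /eqP tt'; case/eqP: ntt'; apply: val_inj.
Qed.

(* Dyson's e-transform: shrinking [A] to [A e :&: B] and enlarging [B] to
   [B + A e] preserves the sum of dimensions; when no [e] shrinks [A], the
   algebra generated by [A] stabilises [B]. *)
Lemma stable_between (F : fieldType) (K : fieldExtType F) (A B : {vspace K}) :
  1 \in A -> B != 0%VS ->
  exists (H : {subfield K}) (V : {vspace K}),
    [/\ (B <= V)%VS, (V <= A * B)%VS, (H * V <= V)%VS
      & (\dim A + \dim B <= \dim V + \dim H)%N].
Proof.
have [k] := ubnP (\dim A); elim: k A B => // k IH A B /ltnSE leAk A1 B0.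
case: (boolP (A * B <= B)%VS) => [AB|nAB].
  exists (agenv_aspace A), B; split => //.
  - by rewrite -{1}[B]prod1v prodvSl.
  - exact: agenv_modl.
  - by rewrite addnC leq_add2l dimvS // sub_agenv.
have [a [b [Aa Bb abB]]] : exists a b, [/\ a \in A, b \in B & a * b \notin B].
  apply: contrapT => nex; case/negP: nAB; apply/prodvP => a b Aa Bb.
  by apply: contrapT => /negP abB; apply: nex; exists a, b.
have b0 : b != 0 by apply: contraNneq abB => ->; rewrite mulr0 mem0v.
set C := (A * <[b]> :&: B)%VS.
(* Dividing by [b] puts [1] back into the first space, since [b] lies in both [A b] and [B]. *)
pose A1' := (C * <[b^-1]>)%VS; pose B1' := (B + A * <[b]>)%VS.
have dA1 : \dim A1' = \dim C by rewrite dim_cosetv ?invr_eq0.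
have dAb : \dim (A * <[b]>) = \dim A by rewrite dim_cosetv.
have memA c : c \in C -> c * b^-1 \in A.
  rewrite memv_cap => /andP[/memv_cosetP[a' Aa' ->] _].
  by rewrite mulfK.
have [||| H [V [BV VAB HV dHV]]] := IH A1' B1'.
(* The intersection is strictly smaller than [A b]: it misses [a b], which is outside [B]. *)
- rewrite dA1; apply: leq_trans leAk; rewrite -dAb.
  rewrite ltn_neqAle dimvS ?capvSl // andbT.
  apply: contraNneq abB => dC.
  have: (C == A * <[b]>)%VS by rewrite eqEdim capvSl dC leqnn.
  move/eqP => eqC; have : a * b \in C by rewrite eqC memv_mul ?memv_line.
  by rewrite memv_cap => /andP[].
- apply/memv_cosetP; exists b; last by rewrite divff.
  by rewrite memv_cap Bb andbT; apply/memv_cosetP; exists 1; rewrite ?mul1r.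
- by rewrite -subv0 subv_add subv0 (negPf B0).
exists H, V; split => //.
- by apply: subv_trans BV; rewrite addvSl.
(* An element of [A1'] is [c / b] with [c] in [A b] and in [B]. Against [B] it counts as an element
   of [A]; against [a' b] the factor [b] cancels and leaves [c a'] with [c] in [B]. *)
- apply: subv_trans VAB _; apply/prodvP => x y.
  move=> /memv_cosetP[c Cc ->] /memv_addP[b' Bb' [z /memv_cosetP[a' Aa' ->] ->]].
  rewrite mulrDr rpredD //; first by rewrite memv_mul // memA.
  rewrite mulrACA mulVf // mulr1 mulrC memv_mul //.
  by move: Cc; rewrite memv_cap => /andP[].
- by apply: leq_trans dHV; rewrite -dAb -[X in (X <= _)%N]dimv_sum_cap dA1 /B1'
  addvC addnC.
Qed.

Section Kneser.
Variables (K : fieldExtType rat) (sub : seq {subfield K}).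
Hypothesis subP : forall H : {subfield K}, H \in sub.

(** For each nonzero [a] in [A], [stable_between] applied to [A a^-1] and [B] gives a subfield [H]
    with [a H B] inside [A B] and the required dimension bound. As there are finitely many
    subfields, the spaces [U H] of all [x] with [x H B] inside [A B] form a finite cover of [A], so
    one of them contains [A]. *)
Lemma linear_kneser (A B : {vspace K}) : A != 0%VS -> B != 0%VS ->
  exists H : {subfield K}, (H * (A * B) <= A * B)%VS /\
    (\dim A + \dim B <= \dim (A * B) + \dim H)%N.
Proof.
move=> A0 B0.
pose U (H : {subfield K}) : {vspace K} :=
  (\bigcap_(k < \dim (H * B)) (amulr (vbasis (H * B))`_k @^-1: (A * B)))%VS.
have UP (H : {subfield K}) x :
    reflect (forall w, w \in (H * B)%VS -> x * w \in (A * B)%VS) (x \in U H).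
  rewrite /U; apply: (iffP idP) => [/subv_bigcapP Ux w /coord_vbasis ->|Ux].
    rewrite mulr_sumr rpred_sum // => k _; rewrite -scalerAr rpredZ //.
    by have := Ux k isT; rewrite -memvE -memv_preim lfunE.
  apply/subv_bigcapP => k _; rewrite -memvE -memv_preim lfunE /=.
  by apply: Ux; apply: vbasis_mem; rewrite mem_nth // size_tuple.
pose s := [seq H : {subfield K} <- sub |
  (\dim A + \dim B <= \dim (A * B) + \dim H)%N].
have loc a : a \in A -> a != 0 -> exists2 H : {subfield K}, H \in s & a \in U H.
  move=> Aa a0; have [|H [V [BV VAB HV dHV]]] :=
    @stable_between _ _ (A * <[a^-1]>) B _ B0.
    by apply/memv_cosetP; exists a; rewrite ?divff.
  have aV v : v \in V -> a * v \in (A * B)%VS.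
    move=> /(subvP VAB); rewrite -prodvA [(<[_]> * _)%VS]prodvC prodvA.
    by move=> /memv_cosetP[c ABc ->]; rewrite mulrC mulfVK.
  exists H.
    rewrite mem_filter subP andbT.
    move: dHV; rewrite dim_cosetv ?invr_eq0 // => /leq_trans; apply.
    rewrite leq_add2r -(dim_cosetv V a0) dimvS //.
    by apply/subvP => x /memv_cosetP[v Vv ->]; rewrite mulrC aV.
  apply/UP => w wHB; apply: aV; apply: (subvP HV).
  by apply: (subvP _ _ wHB); apply: prodvSr.
have : has (fun W : {vspace K} => (A <= W)%VS) (map U s).
  apply: subspace_of_cover => x Ax; rewrite has_map.
  have [x0|/(loc x Ax)[H Hs xH]] := eqVneq x 0; last by apply/hasP; exists H.
  have [H Hs _] := loc _ (memv_pick A) (etrans (congr1 negb (vpick0 A)) A0).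
  by apply/hasP; exists H; rewrite //= x0 mem0v.
rewrite has_map => /hasP[H]; rewrite mem_filter => /andP[dH _] /= AU.
exists H; split => //; rewrite prodvCA; apply/prodvP => a w Aa wHB.
by have /UP := subvP AU _ Aa; apply.
Qed.

(** Take [H] of largest dimension among the subfields stabilising [V W]. Replacing [V] and [W] by
    [H V] and [H W] keeps the product and makes all dimensions multiples of [\dim H], while the
    subfield from [linear_kneser] is no larger than [H]. Counted in units of [\dim H], the product
    has at least [i %/ \dim H + j %/ \dim H + 1] of them. *)
Lemma dim_prodv_gt (i j : nat) (V W : {vspace K}) :
  (forall F : {subfield K}, (i %% \dim F + j %% \dim F = (i + j) %% \dim F)%N) ->
  (i < \dim V)%N -> (j < \dim W)%N -> (i + j < \dim (V * W))%N.
Proof.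
move=> noF iV jW.
pose stab (H : {subfield K}) := (H * (V * W) <= V * W)%VS.
pose P k := has (fun H : {subfield K} => stab H && (\dim H == k)) sub.
have exP : exists k, P k.
  exists 1%N; apply/hasP; exists 1%AS; first exact: subP.
  by rewrite /stab /= prod1v subvv dimv1.
have bP k : P k -> (k <= \dim {:K})%N.
  by case/hasP => H _ /andP[_ /eqP <-]; rewrite dimvS // subvf.
case: (ex_maxnP exP bP) => m /hasP[H _ /andP[sH /eqP dH]] maxm.
have HV v : (\dim H %| \dim (H * v))%N.
  by rewrite field_module_dimS // prodvA (prodv_id H).
have nz k (v : {vspace K}) : (k < \dim v)%N -> (H * v)%VS != 0%VS.
  move=> kv; rewrite -dimv_eq0 -lt0n; apply: leq_ltn_trans (leq0n k) _.
  by apply: leq_trans kv _; rewrite dimvS // -{1}[v]prod1v prodvSl // sub1v.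
have prodE : ((H * V) * (H * W) = V * W)%VS.
  rewrite -prodvA [(V * (H * W))%VS]prodvCA (field_module_eq sH).
  exact: field_module_eq.
have [H' []] := linear_kneser (nz _ _ iV) (nz _ _ jW).
rewrite prodE => sH' dims.
have {sH'} dH' : (\dim H' <= \dim H)%N.
  by rewrite dH; apply: maxm; apply/hasP; exists H';
    rewrite ?subP // /stab sH' eqxx.
have {dims} dims : (\dim (H * V) + \dim (H * W) <= \dim (V * W) + \dim H)%N.
  by apply: leq_trans dims _; rewrite leq_add2l.
have big k (v : {vspace K}) : (k < \dim v)%N ->
    ((k %/ \dim H).+1 * \dim H <= \dim (H * v))%N.
  move=> kv; have /dvdnP[q dq] := HV v;
    rewrite dq leq_mul2r ltn_divLR ?adim_gt0 //.
  rewrite -dq; apply/orP; right; apply: leq_trans kv _.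
  by rewrite dimvS // -{1}[v]prod1v prodvSl // sub1v.
have /dvdnP[q dq] : (\dim H %| \dim (V * W))%N by rewrite field_module_dimS.
have := leq_trans (leq_add (big _ _ iV) (big _ _ jW)) dims.
rewrite dq -mulnDl -mulSnr leq_mul2r eqn0Ngt adim_gt0 /= => le_q.
rewrite -ltn_divLR ?adim_gt0 //.
(* The remainders do not carry, so the quotients add up. *)
have -> : ((i + j) %/ \dim H = i %/ \dim H + j %/ \dim H)%N.
  rewrite divnD ?adim_gt0 //; case: leqP => [le1|_]; last by rewrite addn0.
  by have := ltn_pmod (i + j) (adim_gt0 H); rewrite -noF ltnNge le1.
by move: le_q; rewrite addSn addnS ltnS.
Qed.

End Kneser.

(** * Complex embeddings and subfields *)

Section Embeddings.
Variables (K : fieldExtType rat) (C : numClosedFieldType).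
Local Notation n := (\dim {:K}).

Lemma separable_numfield (F : {subfield K}) x : separable_element F x.
Proof.
by apply: pcharf0_separable => p; rewrite (pchar_lalg K) pchar_num.
Qed.

Lemma primitive_element (F : {subfield K}) :
  exists2 x, x \in F & <<1; x>>%VS = F :> {vspace K}.
Proof.
have sepF : separable 1 F by apply/separableP => y _; exact: separable_numfield.
exists (separable_generator 1 F); first exact: separable_generator_mem.
by rewrite -eq_adjoin_separable_generator // sub1v.
Qed.

Lemma horner_algE (x : K) p : horner_alg x p = (map_poly (in_alg K) p).[x].
Proof. by []. Qed.

Lemma rmorph_rat_alg (s : {rmorphism K -> C}) a : s a%:A = ratr a.
Proof. exact: (fmorph_eq_rat (s \o in_alg K)). Qed.

Lemma rmorph_horner_alg (s : {rmorphism K -> C}) (p : {poly rat}) x :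
  s (horner_alg x p) = (map_poly ratr p).[s x].
Proof.
rewrite horner_algE -horner_map -map_poly_comp; congr (_.[_]).
by apply: eq_map_poly => a; exact: rmorph_rat_alg.
Qed.

Variable t : K.
Hypothesis gen_t : <<1; t>>%VS = {:K}%VS :> {vspace K}.

Lemma horner_alg_surj x : exists p : {poly rat}, x = horner_alg t p.
Proof.
have : x \in <<1; t>>%VS by rewrite gen_t memvf.
by case/Fadjoin1_polyP => p ->; exists p; rewrite horner_algE.
Qed.

Lemma adjoin_degree_gen : adjoin_degree 1 t = n.
Proof. by have := dim_Fadjoin 1 t; rewrite gen_t dimv1 muln1 => ->. Qed.

Lemma power_basis x :
  exists p : 'I_n -> rat, x = \sum_(l < n) p l *: t ^+ l.
Proof.
have xt : x \in <<1; t>>%VS by rewrite gen_t memvf.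
have /polyOver1P[p pE] := Fadjoin_polyOver 1 t x.
exists (fun l => p`_l); rewrite -(Fadjoin_poly_eq xt) pE.
have sp : (size (map_poly (in_alg K) p) <= n)%N.
  by rewrite -pE -adjoin_degree_gen size_Fadjoin_poly.
rewrite (horner_coef_wide _ sp); apply: eq_bigr => l _.
by rewrite coef_map /= mulr_algl.
Qed.

Lemma min_rat_poly : exists f : {poly rat},
  [/\ map_poly (in_alg K) f = minPoly 1 t, f \is monic, size f = n.+1,
      separable_poly f & forall q, (horner_alg t q == 0) = (f %| q)].
Proof.
have /polyOver1P[f fE] := minPolyOver 1 t.
exists f; split => //.
- by rewrite -(map_monic (in_alg K)) -fE monic_minPoly.
- by rewrite -(size_map_poly (in_alg K)) -fE size_minPoly adjoin_degree_gen.
- by rewrite -(separable_map (in_alg K)) -fE; exact: separable_numfield.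
move=> q; rewrite horner_algE -[RHS](dvdp_map (in_alg K)) -fE.
apply/idP/idP => [q0|/dvdpP[g ->]]; last by rewrite hornerM minPolyxx mulr0.
by rewrite minPoly_dvdp // alg_polyOver.
Qed.

(** Sending [p(t)] to [p(r)] is well defined for every root [r] of the minimal polynomial, because a
    rational polynomial vanishing at [t] is a multiple of it. Separability gives [n] distinct roots,
    and any embedding maps [t] to one of them. In the second clause the embedding of index 0 acts on
    rational coefficients, where all embeddings agree. *)
Lemma embeddings_system :
  exists s : 'I_n -> {rmorphism K -> C},
    [/\ injective (fun k => s k t),
        map_poly (s (Ordinal (adim_gt0 {:K}%AS))) (minPoly 1 t) =
          \prod_(k < n) ('X - (s k t)%:P)
      & forall f : {rmorphism K -> C}, exists k, f =1 s k].
Proof.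
have [f [fE fmon fsize fsep fP]] := min_rat_poly.
have [r0] := closed_field_poly_normal (map_poly ratr f : {poly C}).
rewrite (monicP _) ?map_monic // scale1r => fr.
have r0size : size r0 = n.
  by have := congr1 (size : {poly C} -> nat) fr;
    rewrite size_map_poly fsize size_prod_XsubC => -[].
have r0uniq : uniq r0 by rewrite -separable_prod_XsubC -fr separable_map.
pose r (k : 'I_n) := r0`_k.
have rroot k : (map_poly ratr f).[r k] = 0.
  by apply/eqP; rewrite fr -[_ == 0]/(root _ _) root_prod_XsubC mem_nth ?r0size.
(* [g k x] evaluates at [r k] some chosen polynomial representing [x]; [gE] shows independence of
   the choice. *)
pose g k x := (map_poly ratr (projT1 (cid (horner_alg_surj x)))).[r k].
have gE k p : g k (horner_alg t p) = (map_poly ratr p).[r k].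
  rewrite /g; case: cid => q /= pq; apply/eqP.
  rewrite -subr_eq0 -hornerN -hornerD -!rmorphN -rmorphD.
  have : horner_alg t (q - p) == 0 by rewrite rmorphB subr_eq0; apply/eqP;
    exact: esym.
  by rewrite fP => /dvdpP[h ->]; rewrite rmorphM hornerM /= rroot mulr0.
have gB k : zmod_morphism (g k).
  move=> x y; have [p ->] := horner_alg_surj x; have [q ->] := horner_alg_surj y.
  by rewrite -rmorphB !gE rmorphB hornerD hornerN.
have gM k : monoid_morphism (g k).
  split=> [|x y].
    by rewrite -(rmorph1 (horner_alg t)) gE rmorph1 hornerC.
  have [p ->] := horner_alg_surj x; have [q ->] := horner_alg_surj y.
  by rewrite -rmorphM !gE rmorphM hornerM.
pose s k : {rmorphism K -> C} :=
  HB.pack (g k) (GRing.isZmodMorphism.Build K C (g k) (gB k))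
                (GRing.isMonoidMorphism.Build K C (g k) (gM k)).
have st k : s k t = r k.
  by rewrite -{1}[t](horner_algX (A := K)) [LHS]gE map_polyX hornerX.
have mapf (h : {rmorphism K -> C}) : map_poly h (minPoly 1 t) = map_poly ratr f.
  rewrite -fE -map_poly_comp.
  by apply: eq_map_poly => a; exact: rmorph_rat_alg.
exists s; split.
- move=> k l skl; have /eqP : r k = r l by rewrite -!st; exact: skl.
  by rewrite nth_uniq ?r0size // => /eqP/val_inj.
- rewrite mapf fr (big_nth 0) r0size big_mkord.
  by apply: eq_bigr => k _; rewrite st.
move=> h; have : root (map_poly ratr f) (h t).
  by rewrite -(mapf h) fmorph_root root_minPoly.
rewrite fr root_prod_XsubC => /(nthP 0)[k]; rewrite r0size => kn hk.
exists (Ordinal kn) => x; have [p ->] := horner_alg_surj x.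
by rewrite !rmorph_horner_alg st /r hk.
Qed.

Variable s : 'I_n -> {rmorphism K -> C}.
Hypothesis s_inj : injective (fun k => s k t).

(** On the powers of [t], which span [K], this is a linear system for [w] with a Vandermonde matrix,
    invertible because the [s k t] are distinct. *)
Lemma functional_embeddings (phi : {scalar K}) :
  exists w : 'I_n -> C, forall x, ratr (phi x) = \sum_k w k * s k x.
Proof.
pose A := Vandermonde n (\row_k s k t).
have A1 : A \in unitmx.
  rewrite unitmxE det_Vandermonde unitfE; apply/prodf_neq0 => k _.
  apply/prodf_neq0 => l kl; rewrite !mxE subr_eq0.
  by apply: contraTneq kl => /s_inj ->; rewrite ltnn.
pose c := \col_l ratr (phi (t ^+ l)) : 'cV[C]_n.
exists (fun k => (invmx A *m c) k 0) => x.
have [p ->] := power_basis x.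
transitivity (\sum_l ratr (p l) * (A *m (invmx A *m c)) l 0).
  rewrite mulKVmx // linear_sum rmorph_sum /=; apply: eq_bigr => l _.
  by rewrite linearZ /= rmorphM mxE.
under eq_bigr do rewrite mxE mulr_sumr.
rewrite exchange_big; apply: eq_bigr => k _ /=.
rewrite rmorph_sum mulr_sumr; apply: eq_bigr => l _ /=.
rewrite -mulr_algl rmorphM rmorphXn /= rmorph_rat_alg.
by rewrite [A l k]mxE [X in X ^+ _]mxE [RHS]mulrC mulrA.
Qed.

Hypothesis s_split : map_poly (s (Ordinal (adim_gt0 {:K}%AS))) (minPoly 1 t) =
          \prod_(k < n) ('X - (s k t)%:P).

(** The coefficients of the common polynomial lie in the intersection [I], so the degree of [t] over
    [I] is at most that over [E]. As [t] generates [K] over both, [I] has at least the dimension of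
    [E], hence equals it. *)
Lemma eq_subfield_minPoly (H H' : {subfield K}) :
  minPoly H t = minPoly H' t -> H = H'.
Proof.
suff sub (E F : {subfield K}) : minPoly E t = minPoly F t -> (E <= F)%VS.
  by move=> e; apply/val_inj/eqP; rewrite eqEsubv /= !sub.
move=> eqp; pose I := (E :&: F)%AS.
have full (G : {subfield K}) : <<G; t>>%VS = {:K}%VS :> {vspace K}.
  apply/eqP; rewrite eqEsubv subvf -gen_t /=; apply/FadjoinP; split.
    by rewrite sub1v.
  exact: memv_adjoin.
have : minPoly I t %| minPoly E t.
  rewrite minPoly_dvdp ?root_minPoly //; apply/polyOverP => k.
  by rewrite memv_cap {2}eqp !(polyOverP _ _) ?minPolyOver.
move/dvdp_leq => /(_ (monic_neq0 (monic_minPoly _ _))).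
rewrite !size_minPoly ltnS => ad.
have := dim_Fadjoin I t; have := dim_Fadjoin E t.
rewrite !full => -> eI.
have : (\dim E <= \dim I)%N.
  have : (adjoin_degree E t * \dim E <= adjoin_degree E t * \dim I)%N.
    by rewrite eI leq_mul2r ad orbT.
  by rewrite leq_pmul2l.
move=> dEI; have : (I == E :> {vspace K})%VS by rewrite eqEdim capvSl.
by move/eqP => <-; exact: capvSr.
Qed.

(** A subfield is determined by the minimal polynomial of [t] over it, a monic divisor of the split
    polynomial [minPoly 1 t]; such a divisor is given by a mask on the list of roots. Masks that
    match no subfield get the default [1%AS]. *)
Lemma subfields_finite_of_splitting :
  exists l : seq {subfield K}, forall H, H \in l.
Proof.
move: s_split; set s0 := s _ => split0.
pose P (m : n.-tuple bool) : set {subfield K} := [set H : {subfield K} |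
  map_poly s0 (minPoly H t) =
  \prod_(x <- mask m [seq s k t | k <- enum 'I_n]) ('X - x%:P)].
exists [seq xget 1%AS (P m) | m <- enum {: n.-tuple bool}] => H.
have dv : map_poly s0 (minPoly H t) %|
    \prod_(x <- [seq s k t | k <- enum 'I_n]) ('X - x%:P).
  by rewrite big_map big_enum -split0 dvdp_map minPolyS // sub1v.
have [m0] := dvdp_prod_XsubC dv.
have /subseqP[m sizem ->] := mask_subseq m0 [seq s k t | k <- enum 'I_n].
rewrite eqp_monic ?monic_prod_XsubC ?map_monic ?monic_minPoly // => /eqP Hm.
have szm : size m == n by rewrite sizem size_map size_enum_ord.
apply/mapP; exists (Tuple szm); first by rewrite mem_enum.
case: xgetP => [H' _|/(_ H)]; last by case.
rewrite /P /= -Hm => /(map_inj_poly (fmorph_inj _) (rmorph0 _)).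
by move/eq_subfield_minPoly.
Qed.
End Embeddings.

Lemma subfields_finite (K : fieldExtType rat) :
  exists l : seq {subfield K}, forall H, H \in l.
Proof.
have [t _ gen_t] := primitive_element {:K}%AS.
have [s [sinj ssplit _]] := embeddings_system algC gen_t.
exact: (subfields_finite_of_splitting gen_t ssplit).
Qed.

(** * The norm *)

Lemma normc_ge0 (R : rcfType) (z : R[i]) : 0 <= normc z.
Proof. by case: z => a b; rewrite sqrtr_ge0. Qed.

Lemma normc_sum (R : rcfType) (I : finType) (f : I -> R[i]) :
  normc (\sum_k f k) <= \sum_k normc (f k).
Proof.
elim/big_ind2: _ => [|x a y b xa yb|//]; first by rewrite normc0.
exact: le_trans (le_normcD _ _) (lerD xa yb).
Qed.

Lemma normc_ratr (R : realType) (q : rat) : normc (ratr q : R[i]) = `|ratr q|.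
Proof.
rewrite -(fmorph_eq_rat (real_complex R \o ratr)) /=.
by rewrite expr0n addr0 sqrtr_sqr.
Qed.

Section Norm.
Variables (R : realType) (K : fieldExtType rat).
Local Notation n := (\dim {:K}).

Lemma norm_embeddings : exists s : 'I_n -> {rmorphism K -> R[i]},
  [/\ injective (fun k => s k : K -> R[i]),
      forall f : {rmorphism K -> R[i]}, exists k, f =1 s k,
      forall x, Knorm R x = Num.sqrt (n%:R^-1 * \sum_k normc (s k x) ^+ 2)
    & forall phi : {scalar K}, exists w : 'I_n -> R[i],
        forall x, ratr (phi x) = \sum_k w k * s k x].
Proof.
have [t _ gen_t] := primitive_element {:K}%AS.
have [s [sinj _ sall]] := embeddings_system R[i] gen_t.
have sinj' : injective (fun k => s k : K -> R[i]).
  by move=> k l skl; apply: sinj; rewrite /= skl.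
exists s; split => //; last by exact: (functional_embeddings gen_t sinj).
move=> x; congr (Num.sqrt (_ * _)).
have -> : @embeddings R K = (fun k => s k : K -> R[i]) @` [set` enum 'I_n].
  apply/seteqP; split => [f [g _ <-]|f [k _ <-]]; last by exists (s k).
  have [k gk] := sall g; exists k; first by rewrite /= mem_enum.
  by apply/funext => y; rewrite gk.
rewrite fsbig_image; last by move=> k l _ _; exact: sinj'.
rewrite -fsbig_seq ?enum_uniq // big_enum; apply: eq_bigr => k _.
by rewrite normc_def -rmorphXn /=; case: (s k x).
Qed.

Lemma Knorm_ge0 (x : K) : 0 <= Knorm R x.
Proof. exact: sqrtr_ge0. Qed.

Lemma KnormZ (a : rat) (x : K) : Knorm R (a *: x) = `|ratr a| * Knorm R x.
Proof.
have [s [_ _ NE _]] := norm_embeddings.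
rewrite !NE -[`|_|]ger0_norm // -sqrtr_sqr -sqrtrM ?sqr_ge0 //.
congr Num.sqrt; rewrite mulrCA; congr (_ * _); rewrite mulr_sumr.
apply: eq_bigr => k _; rewrite -mulr_algl rmorphM (rmorph_rat_alg (s k)) normcM.
by rewrite normc_ratr exprMn.
Qed.

(** Bounding each [|s x|^2] by the full sum [n |x|^2] gives at most [n^2 |x|^2 |y|^2] for the sum of
    the [|s x|^2 |s y|^2]; averaging leaves one factor [n] under the root. *)
Lemma KnormM (x y : K) :
  Knorm R (x * y) <= Num.sqrt n%:R * Knorm R x * Knorm R y.
Proof.
have [s [_ _ NE _]] := norm_embeddings.
have n0 : n%:R != 0 :> R by rewrite pnatr_eq0 -lt0n (adim_gt0 {:K}%AS).
have sum0 z : 0 <= \sum_k normc (s k z) ^+ 2.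
  by rewrite sumr_ge0 // => k _; rewrite sqr_ge0.
rewrite !NE -sqrtrM ?ler0n // -sqrtrM ?mulr_ge0 ?invr_ge0 ?ler0n ?sum0 //.
  rewrite ler_wsqrtr // mulrA (mulrA _ _ (\sum_k _)) divff // mul1r.
rewrite [X in _ <= X * _]mulrC -mulrA ler_wpM2l ?invr_ge0 // mulr_sumr ler_sum
  // => k _.
rewrite rmorphM normcM exprMn ler_wpM2r ?sqr_ge0 //.
by rewrite (bigD1 k) //= lerDl sumr_ge0 // => l _; rewrite sqr_ge0.
Qed.

(** [phi] is a combination of embeddings, and each [|s x|] is at most [sqrt n] times the norm of
    [x]. Applied to coordinates, this gives finiteness of balls and lower bounds for minima. *)
Lemma functional_bound (phi : {scalar K}) :
  exists2 c : R, 0 <= c & forall x, `|ratr (phi x)| <= c * Knorm R x.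
Proof.
have [s [_ _ NE /(_ phi)[w phiE]]] := norm_embeddings.
have n0 : n%:R != 0 :> R by rewrite pnatr_eq0 -lt0n (adim_gt0 {:K}%AS).
exists (\sum_k normc (w k) * Num.sqrt n%:R).
  by rewrite sumr_ge0 // => k _; rewrite mulr_ge0 ?normc_ge0 ?sqrtr_ge0.
move=> x; rewrite -normc_ratr phiE (le_trans (normc_sum _)) // mulr_suml.
rewrite ler_sum // => k _; rewrite normcM -mulrA ler_wpM2l ?normc_ge0 //.
rewrite NE -sqrtrM // mulrA divff // mul1r.
rewrite -[X in X <= _]ger0_norm ?normc_ge0 // -sqrtr_sqr ler_wsqrtr //.
by rewrite (bigD1 k) //= lerDl sumr_ge0 // => l _; rewrite sqr_ge0.
Qed.

(** Composition with [g] permutes the embeddings. *)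
Lemma Knorm_rmorph (g : {rmorphism K -> K}) (x : K) :
  (forall y, exists z, g z = y) -> Knorm R (g x) = Knorm R x.
Proof.
move=> gsurj; have [s [sinj sall NE _]] := norm_embeddings.
have [p pE] := choice (fun k => sall (s k \o g)).
have pinj : injective p.
  move=> k l pkl; apply: sinj; apply/funext => y; have [z <-] := gsurj y.
  by have := pE k z; have := pE l z; rewrite /= pkl => -> ->.
rewrite !NE [in RHS](reindex_inj pinj) /=; congr (Num.sqrt (_ * _)).
by apply: eq_bigr => k _; have /= -> := pE k x.
Qed.

End Norm.

(** * Successive minima *)

Lemma seq_argmin (R : realDomainType) (T : eqType) (f : T -> R) (s : seq T) x0 :
  x0 \in s -> exists2 x, x \in s & forall y, y \in s -> f x <= f y.
Proof.
elim: s x0 => // a s IH x0 _.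
case: s IH => [_|b s IH].
  by exists a; rewrite ?mem_head // => y; rewrite inE => /eqP ->.
have [x xs xmin] := IH b (mem_head _ _).
have [ax|xa] := leP (f a) (f x).
  exists a; first exact: mem_head.
  move=> y; rewrite in_cons => /orP[/eqP -> //|/xmin]; exact: le_trans.
exists x; first by rewrite in_cons xs orbT.
move=> y; rewrite in_cons => /orP[/eqP ->|/xmin //]; exact: ltW.
Qed.

Section Lattice.
Variable K : fieldExtType rat.
Local Notation n := (\dim {:K}).
Implicit Types (L O : set K) (b : n.-tuple K).

Lemma inIntSpanP b x : basis_of {:K} b ->
  inIntSpan b x <-> forall k, coord b k x \is a Num.int.
Proof.
move=> bb; split=> [[a ->] k|xint].
  under eq_bigr do rewrite -scaler_int.
  by rewrite coord_sum_free ?(basis_free bb) ?intr_int.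
exists [ffun k => Num.floor (coord b k x)].
rewrite {1}(coord_basis bb (memvf x)); apply: eq_bigr => k _.
by rewrite ffunE -scaler_int floorK.
Qed.

Lemma Zbasis_mem L b x : is_Zbasis L b ->
  L x <-> forall k, coord b k x \is a Num.int.
Proof. by case=> bb ->; exact: inIntSpanP. Qed.

Lemma Zbasis_nth L b (k : 'I_n) : is_Zbasis L b -> L b`_k.
Proof.
move=> Lb; apply/(Zbasis_mem _ Lb) => l; case: Lb => bb _.
by rewrite coord_free ?(basis_free bb) // natr_int.
Qed.

Lemma Qspan_mono (A A' : set K) : A `<=` A' -> (Qspan A <= Qspan A')%VS.
Proof.
move=> AA'; apply: (proj2 (QspanP A)) => x /AA'.
exact: (proj1 (QspanP A')).
Qed.

Lemma mem_Qspan (A : set K) x : A x -> x \in Qspan A.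
Proof. exact: (proj1 (QspanP A)). Qed.

Lemma Qspan_sub (A : set K) (W : {vspace K}) :
  (forall x, A x -> x \in W) -> (Qspan A <= W)%VS.
Proof. exact: (proj2 (QspanP A)). Qed.

Variable R : realType.

Lemma Knorm_eq0 (x : K) : Knorm R x = 0 -> x = 0.
Proof.
move=> x0; rewrite (coord_basis (vbasisP {:K}) (memvf x)) big1 // => k _.
have [c _ /(_ x)] := functional_bound R (coord (vbasis {:K}) k).
by rewrite x0 mulr0 normr_le0 fmorph_eq0 => /eqP ->; rewrite scale0r.
Qed.

Lemma Knorm0 : Knorm R (0 : K) = 0.
Proof. by rewrite -(scale0r 0) KnormZ rmorph0 normr0 mul0r. Qed.

Lemma coord_bound b : exists2 c : R, 0 < c &
  forall k x, `|ratr (coord b k x)| <= c * Knorm R x.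
Proof.
pose P k (c : R) := 0 <= c /\ forall x, `|ratr (coord b k x)| <= c * Knorm R x.
have exP k : exists c, P k c.
  by have [c c0 cP] := functional_bound R (coord b k); exists c.
have [c cP] := choice exP.
exists (1 + \sum_k c k) => [|k x].
  by rewrite ltr_wpDr // sumr_ge0 // => k _; case: (cP k).
have [_ /(_ x)] := cP k => /le_trans; apply.
rewrite ler_wpM2r ?Knorm_ge0 // (bigD1 k) //= addrCA lerDl.
by rewrite addr_ge0 // sumr_ge0 // => l _; case: (cP l).
Qed.

Lemma finite_ball L (r : R) : full_rank_lattice L ->
  finite_set [set x | L x /\ Knorm R x <= r].
Proof.
move=> [b Lb]; have [c c0 cP] := coord_bound b.
have bb : basis_of {:K} b by case: Lb.
pose B := Num.bound `|c * r|.
(* Ordinals below [2 B + 1], shifted by [B], encode the integers from [-B] to [B]. *)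
pose f (v : {ffun 'I_n -> 'I_(B + B).+1}) : K :=
  \sum_k ((v k : int) - (B : int))%:~R *: b`_k.
apply: (@sub_finite_set _ _ (f @` [set: _])); last first.
  by apply: finite_image; exact: finite_finset.
move=> x [/(Zbasis_mem _ Lb) xint xr].
have bnd k : `|Num.floor (coord b k x)| <= B :> int.
  rewrite -(ler_int R) intr_norm.
  have -> : (Num.floor (coord b k x))%:~R = ratr (coord b k x) :> R.
    by rewrite -[in RHS](floorK (xint k)) ratr_int.
  apply: le_trans (cP _ _) _; apply: (@le_trans _ _ (c * r)).
    by rewrite ler_wpM2l // ltW.
  by apply: le_trans (ler_norm _) _; exact: ltW (archi_boundP (normr_ge0 _)).
pose g k := absz (Num.floor (coord b k x) + B)%R.
have gE k : (g k)%:Z = Num.floor (coord b k x) + B.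
  rewrite /g gez0_abs //; have := bnd k; rewrite ler_norml => /andP[h _].
  by rewrite -lerBlDr sub0r.
have gB k : (g k < (B + B).+1)%N.
  rewrite ltnS -lez_nat gE PoszD lerD2r.
  by have := bnd k; rewrite ler_norml => /andP[].
exists [ffun k => Ordinal (gB k)] => //.
rewrite /f [RHS](coord_basis bb (memvf x)); apply: eq_bigr => k _.
by rewrite ffunE /= gE addrK floorK.
Qed.

Definition ball_span L (r : R) := Qspan [set x | L x /\ Knorm R x <= r].

(** The minimum is attained because finitely many norms matter. The ball of radius [r0] contains a
    basis and is finite, and an admissible [r <= r0] can be lowered to the largest norm of a lattice
    vector in its ball without shrinking the span. *)
Lemma succ_minP L i : full_rank_lattice L -> (i < n)%N ->
  [/\ 0 < succ_min R L i, (i < \dim (ball_span L (succ_min R L i)))%N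
    & forall r, 0 < r -> (i < \dim (ball_span L r))%N -> succ_min R L i <= r].
Proof.
move=> latL ltin.
pose A : set R := [set r | 0 < r /\ (i.+1 <= \dim (ball_span L r))%N].
suff [r Ar] : exists r, (A `&` lbound A) r.
  have [[]] : (A `&` lbound A) (succ_min R L i) by apply: (xgetPex 0); exists r.
  by move=> ? ? lb; split => // r' ? ?; apply: lb.
have [b Lb] := latL; have bb : basis_of {:K} b by case: Lb.
pose r0 := 1 + \sum_(k < n) Knorm R b`_k.
have r00 : 0 < r0 by rewrite ltr_wpDr // sumr_ge0 // => k _; exact: Knorm_ge0.
have Ar0 : A r0.
  split => //; suff -> : ball_span L r0 = {:K}%VS by [].
  apply/eqP; rewrite eqEsubv subvf -(span_basis bb) /=; apply/span_subvP => x.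
  move=> /(nthP 0)[k]; rewrite size_tuple => kn <-; apply: mem_Qspan; split.
    exact: (Zbasis_nth (Ordinal kn) Lb).
  rewrite /r0 (bigD1 (Ordinal kn)) //= addrCA lerDl addr_ge0 // sumr_ge0 // =>
    l _.
  exact: Knorm_ge0.
have /finite_seqP[s sE] := finite_ball r0 latL.
have sP x : (x \in s) <-> (L x /\ Knorm R x <= r0).
  by have := congr1 (fun S : set K => S x) sE; rewrite /= => ->.
pose s' := [seq x <- s | `[< A (Knorm R x) >]].
have key r : A r -> r <= r0 -> exists2 x, x \in s' & Knorm R x <= r.
  move=> [r_gt0 dr] rr0.
  have L0 : 0 \in [seq x <- s | Knorm R x <= r].
    rewrite mem_filter Knorm0 ltW //=; apply/sP; rewrite Knorm0 ltW //;
      split => //.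
    by apply/(Zbasis_mem _ Lb) => k; rewrite linear0.
  have [t] := seq_argmin (fun x => - Knorm R x) L0.
  rewrite mem_filter => /andP[tr ts] tmax.
  have {}tmax x : L x -> Knorm R x <= r -> Knorm R x <= Knorm R t.
    move=> Lx xr; rewrite -lerN2 tmax // mem_filter xr /=; apply/sP; split => //.
    exact: le_trans rr0.
  exists t => //; rewrite mem_filter ts andbT; apply/asboolP; split.
    rewrite lt_neqAle Knorm_ge0 andbT eq_sym; apply: contraTneq dr => t0.
    rewrite -leqNgt (@leq_trans 0) // leqn0 dimv_eq0 -subv0.
    apply: Qspan_sub => x [Lx /(tmax _ Lx)]; rewrite t0 => x0.
    have /Knorm_eq0 -> : Knorm R x = 0 by apply/eqP; rewrite eq_le x0 Knorm_ge0.
    exact: mem0v.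
  apply: leq_trans dr _; apply: dimvS; apply: Qspan_mono => x [Lx xr].
  by split => //; exact: tmax.
have [x0 x0s _] := key _ Ar0 (lexx _).
have [x] := seq_argmin (@Knorm R K) x0s; rewrite mem_filter.
move=> /andP[/asboolP Ax xs] xmin; exists (Knorm R x); split => // r Ar.
have [rr0|/ltW r0r] := leP r r0.
  by have [y ys' yr] := key r Ar rr0; apply: le_trans yr; exact: xmin.
by apply: le_trans r0r; have /sP[] := xs.
Qed.

Lemma succ_minM O i j : is_order O -> (i + j < n)%N ->
  (forall F : {subfield K}, (i %% \dim F + j %% \dim F = (i + j) %% \dim F)%N) ->
  succ_min R O (i + j) <= Num.sqrt n%:R * succ_min R O i * succ_min R O j.
Proof.
move=> [latO _ mulO] ij_lt noF; have [l lP] := subfields_finite K.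
have i_lt : (i < n)%N := leq_ltn_trans (leq_addr _ _) ij_lt.
have j_lt : (j < n)%N := leq_ltn_trans (leq_addl _ _) ij_lt.
have [i0 idim _] := succ_minP latO i_lt.
have [j0 jdim _] := succ_minP latO j_lt.
have [_ _ ijmin] := succ_minP latO ij_lt.
apply: ijmin.
  by rewrite !mulr_gt0 // sqrtr_gt0 ltr0n (adim_gt0 {:K}%AS).
apply: leq_trans (dim_prodv_gt lP noF idim jdim) _; apply: dimvS.
set W := ball_span O (_ * _).
have prodW x y : O x -> O y -> Knorm R x <= succ_min R O i ->
    Knorm R y <= succ_min R O j -> x * y \in W.
  move=> Ox Oy xi yj; apply: mem_Qspan; split; first exact: mulO.
  apply: le_trans (KnormM _ _ _) _;
    rewrite ler_pM ?mulr_ge0 ?sqrtr_ge0 ?Knorm_ge0 //.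
  by rewrite ler_wpM2l ?sqrtr_ge0.
(* For fixed [y] the [x] with [x y] in [W] form a subspace, so the minimality of [Qspan] carries the
   inclusion from short vectors to their spans, one factor at a time. *)
have colon (U : {vspace K}) y : (forall x, x \in U -> x * y \in W) <->
    (U <= amulr y @^-1: W)%VS.
  split=> [UW|/subvP UW x /UW]; last by rewrite -memv_preim lfunE.
  by apply/subvP => x /UW xyW; rewrite -memv_preim lfunE.
apply/prodvP => x y Vx Vy; rewrite mulrC.
suff : forall z, z \in ball_span O (succ_min R O j) -> z * x \in W by apply.
apply/colon; apply: Qspan_sub => z [Oz zj]; rewrite -memv_preim lfunE /= mulrC.
suff : forall z', z' \in ball_span O (succ_min R O i) -> z' * z \in W by apply.
apply/colon; apply: Qspan_sub => z' [Oz' zi]; rewrite -memv_preim lfunE /=.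
exact: prodW.
Qed.

End Lattice.

(** * Discriminants *)

Lemma det_int (m : nat) (P : 'M[rat]_m) :
  (forall i j, P i j \is a Num.int) -> \det P \is a Num.int.
Proof.
move=> Pint; rewrite rpred_sum // => s _; rewrite rpredM //.
  by rewrite rpredX // rpredN rpred1.
by rewrite rpred_prod.
Qed.

Lemma norm_int_unit (x y : rat) :
  x \is a Num.int -> y \is a Num.int -> x * y = 1 -> `|x| = 1.
Proof.
move=> /intrP[a ->] /intrP[b ->]; rewrite mulrC -intrM => /eqP.
rewrite -[1]/(1%:~R) eqr_int => /eqP/intUnitRing.unitzPl; rewrite qualifE.
by case/orP => /eqP ->; rewrite ?rmorphN ?normrN normr1.
Qed.

Section Disc.
Variable K : fieldExtType rat.
Local Notation n := (\dim {:K}).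
Implicit Types (L O : set K) (b c : n.-tuple K).

Fact trK_is_linear : linear (@trK K : K -> rat^o).
Proof. by move=> a x y; rewrite /trK linearP passmx.mxof_linear linearP. Qed.
HB.instance Definition _ :=
  GRing.isSemilinear.Build rat K rat^o _ (@trK K)
    (GRing.semilinear_linear trK_is_linear).

Lemma trK1 : trK (1 : K) = n%:R.
Proof.
rewrite /trK; have -> : amulr (1 : K) = \1%VF by apply/lfunP => x;
  rewrite !lfunE /= mulr1.
by rewrite passmx.mxof1 ?(basis_free (vbasisP _)) // mxtrace1.
Qed.

(** A nonzero [x] orthogonal to a basis would be orthogonal to [x^-1], but the trace of [1] is
    [n]. *)
Lemma trK_nondegenerate b x : basis_of {:K} b ->
  (forall k : 'I_n, trK (x * b`_k) = 0) -> x = 0.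
Proof.
move=> bb tr0; apply: contrapT => /eqP x0.
have : trK (x * x^-1) = 0.
  rewrite [x^-1](coord_basis bb (memvf _)) mulr_sumr linear_sum big1 //= => k _.
  by rewrite -scalerAr linearZ /= tr0 scaler0.
by rewrite divff // trK1 => /eqP;
  rewrite pnatr_eq0 -leqn0 leqNgt (adim_gt0 {:K}%AS).
Qed.

Definition gram b : 'M[rat]_n := \matrix_(i, j) trK (tnth b i * tnth b j).

Lemma gram_change b c (P : 'M[rat]_n) :
  (forall i : 'I_n, c`_i = \sum_k P i k *: b`_k) -> gram c = P *m gram b *m P^T.
Proof.
move=> cP; apply/matrixP => i j; rewrite !mxE !(tnth_nth 0) !cP mulr_sumr
  linear_sum /=.
apply: eq_bigr => l _; rewrite !mxE [in LHS]mulr_suml linear_sum /= mulr_suml.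
apply: eq_bigr => k _; rewrite !mxE !(tnth_nth 0) -scalerAl -scalerAr !linearZ /=.
by rewrite -[LHS]/(P i k * (P j l * _)) [P j l * _]mulrC mulrA.
Qed.

Lemma basis_disc_change b c (P : 'M[rat]_n) :
  (forall i : 'I_n, c`_i = \sum_k P i k *: b`_k) ->
  basis_disc c = \det P ^+ 2 * basis_disc b.
Proof.
move=> /gram_change cP; rewrite /basis_disc -/(gram c) -/(gram b) cP.
by rewrite !det_mulmx det_tr mulrAC expr2.
Qed.

Lemma basis_disc_neq0 b : basis_of {:K} b -> basis_disc b != 0.
Proof.
move=> bb; apply/det0P => -[v v0 vG].
case/eqP: v0; apply/rowP => k; rewrite mxE.
have x0 : \sum_k v 0 k *: b`_k = 0.
  apply: (trK_nondegenerate bb) => l.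
  have := congr1 (fun M : 'rV_n => M 0 l) vG; rewrite !mxE => <-.
  rewrite mulr_suml linear_sum; apply: eq_bigr => m _ /=.
  by rewrite !mxE !(tnth_nth 0) -scalerAl linearZ.
by have := coord_sum_free (v 0) k (basis_free bb); rewrite x0 linear0.
Qed.

Definition basis_mx b c : 'M[rat]_n := \matrix_(i, k) coord b k c`_i.

Lemma basis_mxE b c (i : 'I_n) : basis_of {:K} b ->
  c`_i = \sum_k basis_mx b c i k *: b`_k.
Proof.
move=> bb; rewrite {1}(coord_basis bb (memvf c`_i)).
by apply: eq_bigr => k _; rewrite mxE.
Qed.

Lemma basis_mxM b c : basis_of {:K} b -> basis_of {:K} c ->
  basis_mx b c *m basis_mx c b = 1%:M.
Proof.
move=> bb cc; apply/matrixP => i j;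
  rewrite !mxE -(coord_free _ _ (basis_free cc)).
rewrite [in RHS](basis_mxE c i bb) linear_sum /=.
by apply: eq_bigr => k _; rewrite linearZ /= !mxE.
Qed.

Lemma basis_mx_int L b c : is_Zbasis L b -> (forall i : 'I_n, L c`_i) ->
  forall i j, basis_mx b c i j \is a Num.int.
Proof. by move=> Lb Lc i j; rewrite mxE;
  exact: (proj1 (Zbasis_mem _ Lb) (Lc i)). Qed.

(** The transition matrices between two Z-bases are integral and mutually inverse, so their
    determinants are [1] or [-1]. *)
Lemma abs_discE L b : is_Zbasis L b -> abs_disc L = `|basis_disc b|.
Proof.
move=> Lb; rewrite /abs_disc; set c := xget _ _.
have Lc : is_Zbasis L c by apply: (xgetPex _ (ex_intro _ b Lb)).
have bb : basis_of {:K} b by case: Lb.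
have cc : basis_of {:K} c by case: Lc.
rewrite (basis_disc_change (fun i => basis_mxE c i bb)) normrM normrX.
suff -> : `|\det (basis_mx b c)| = 1 by rewrite expr1n mul1r.
apply: (@norm_int_unit _ (\det (basis_mx c b))).
- by apply: det_int; apply: (basis_mx_int Lb) => i; exact: Zbasis_nth Lc.
- by apply: det_int; apply: (basis_mx_int Lc) => i; exact: Zbasis_nth Lb.
by rewrite -det_mulmx basis_mxM // det1.
Qed.

Lemma abs_disc_gt0 L : full_rank_lattice L -> 0 < abs_disc L.
Proof.
move=> [b Lb]; rewrite (abs_discE Lb) normr_gt0.
by apply: basis_disc_neq0; case: Lb.
Qed.

(** Multiplication by [g x] is the conjugate by [g] of multiplication by [x]. *)
Lemma trK_lrmorph (g : 'End(K)) x : lker g == 0%VS ->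
  (forall u v, g (u * v) = g u * g v) -> trK (g x) = trK x.
Proof.
move=> g0 gM; pose v := vbasis {:K}; have vb : basis_of {:K} v := vbasisP _.
pose G := passmx.mxof v v g; pose G' := passmx.mxof v v g^-1%VF.
have GG' : G *m G' = 1%:M.
  by rewrite -(passmx.mxof_comp _ _ vb) lker0_compVf // passmx.mxof1
    ?(basis_free vb).
have e : (amulr (g x) \o g = g \o amulr x)%VF.
  by apply/lfunP => u; rewrite !lfunE /= !lfunE /= gM.
have {e} := congr1 (passmx.mxof v v) e; rewrite !(passmx.mxof_comp _ _ vb) => e.
rewrite /trK -/v -[X in \tr X]mul1mx -(mulmx1C GG') -mulmxA e mulmxA.
by rewrite mxtrace_mulC mulmxA GG' mul1mx.
Qed.

End Disc.

(** * Orders of bounded discriminant *)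

Section Bounded.
Variable K : fieldExtType rat.
Local Notation n := (\dim {:K}).
Implicit Types (L O : set K) (b c : n.-tuple K).
Local Notation v := (vbasis {:K}).

(** Multiplication by [x] acts on a Z-basis through an integer matrix, and the basis, read as a
    vector over [K], is an eigenvector for the eigenvalue [x]; so [x] is a root of the
    characteristic polynomial. *)
Lemma order_integral O x : is_order O -> O x -> integralOver (intr : int -> K) x.
Proof.
move=> [[b Ob] _ mulO] Ox; have bb : basis_of {:K} b by case: Ob.
pose A : 'M[int]_n := \matrix_(i, k) Num.floor (coord b i (x * b`_k)).
exists (char_poly A); first exact: char_poly_monic.
rewrite map_char_poly -eigenvalue_root_char; apply/eigenvalueP.
exists (\row_k b`_k); last first.
  apply/negP => /eqP/rowP/(_ (Ordinal (adim_gt0 {:K}%AS))); rewrite !mxE => b0.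
  have := basis_not0 bb (mem_nth 0 (_ : 0 < size b)%N).
  by rewrite size_tuple (adim_gt0 {:K}%AS) b0 eqxx => /(_ isT).
apply/rowP => k; rewrite !mxE [in RHS](coord_basis bb (memvf (x * b`_k))).
apply: eq_bigr => i _; rewrite !mxE.
have /floorK {2}<- : coord b i (x * b`_k) \is a Num.int.
  by apply: (proj1 (Zbasis_mem _ Ob)); apply: mulO => //; exact: Zbasis_nth Ob.
by rewrite scaler_int mulrzr.
Qed.

Definition regmx (x : K) : 'M[rat]_n := passmx.mxof v v (amulr x).

Fact regmx_is_linear : linear regmx.
Proof. by move=> a x y; rewrite /regmx linearP passmx.mxof_linear. Qed.
HB.instance Definition _ := GRing.isSemilinear.Build rat K 'M[rat]_n _ regmx
    (GRing.semilinear_linear regmx_is_linear).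

Lemma regmx1 : regmx 1 = 1%:M.
Proof.
rewrite /regmx; have -> : amulr (1 : K) = \1%VF by apply/lfunP => x;
  rewrite !lfunE /= mulr1.
by rewrite passmx.mxof1 ?(basis_free (vbasisP _)).
Qed.

Lemma regmxM x y : regmx (x * y) = regmx x *m regmx y.
Proof.
rewrite /regmx -(passmx.mxof_comp _ _ (vbasisP _)); congr (passmx.mxof _ _ _).
by apply/lfunP => u; rewrite !lfunE /= !lfunE /= mulrA.
Qed.

(** The trace is the sum of the eigenvalues in [algC] of the multiplication matrix. Each is a root
    of the integral equation of [x], hence an algebraic integer, and a rational algebraic integer is
    an integer. *)
Lemma trK_integral x : integralOver (intr : int -> K) x -> trK x \is a Num.int.
Proof.
move=> [p pmon /rootP px].
pose Mc : 'M[algC]_n := map_mx ratr (regmx x).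
have trE : \tr Mc = ratr (trK x) by rewrite trace_map_mx.
have [r] := closed_field_poly_normal (char_poly Mc).
rewrite (monicP (char_poly_monic _)) scale1r => rE.
have rsize : size r = n.
  by have := congr1 (size : {poly algC} -> nat) rE;
    rewrite size_char_poly size_prod_XsubC => -[].
have n0 : (0 < n)%N := adim_gt0 {:K}%AS.
suff Arx : ratr (trK x) \in Aint.
  have /intrP[m] := Cint_rat_Aint (Crat_rat _) Arx.
  by rewrite -(ratr_int algC) => /fmorph_inj ->; rewrite intr_int.
rewrite -trE -[\tr Mc]opprK -char_poly_trace // rE -rsize coefPn_prod_XsubC;
  last first.
  by rewrite rsize -lt0n.
rewrite opprK big_seq rpred_sum // => z.
rewrite -root_prod_XsubC -rE -eigenvalue_root_char => /eigenvalueP[w wE w0].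
have pow k : w *m map_mx ratr (regmx (x ^+ k)) = z ^+ k *: w.
  elim: k => [|k IH]; first by rewrite expr0 regmx1 map_mx1 mulmx1 scale1r.
  by rewrite exprSr regmxM map_mxM mulmxA IH -scalemxAl wE scalerA exprSr.
apply: (@root_monic_Aint (map_poly intr p)); first last.
- by apply/polyOverP => k; rewrite coef_map intr_int.
- exact: monic_map.
have : w *m map_mx ratr (regmx (map_poly intr p).[x]) = 0.
  by rewrite px linear0 map_mx0 mulmx0.
have sp : (size (map_poly (intr : int -> K) p) <= size p)%N by exact: size_poly.
rewrite (horner_coef_wide _ sp) linear_sum map_mx_sum mulmx_sumr /=.
have sp' : (size (map_poly (intr : int ->
  algC) p) <= size p)%N by exact: size_poly.
rewrite /root (horner_coef_wide _ sp') => pz.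
have : (\sum_(k < size p) (map_poly intr p)`_k * z ^+ k) *: w == 0.
  rewrite -[X in _ == X]pz scaler_suml; apply/eqP; apply: eq_bigr => k _.
  have -> : (map_poly intr p)`_k * x ^+ k = (p`_k)%:~R *: x ^+ k.
    by rewrite coef_map /= mulrzl scaler_int.
  by rewrite coef_map linearZ /= map_mxZ -scalemxAr pow scalerA /= ratr_int.
by rewrite scaler_eq0 (negPf w0) orbF.
Qed.

(** [x * y] may lie in neither order, but it is integral as a product of integral elements. *)
Lemma trK_order_int O O' x y : is_order O -> is_order O' -> O x -> O' y ->
  trK (x * y) \is a Num.int.
Proof.
move=> oO oO' Ox Oy; apply: trK_integral; apply: integral_mul.
  exact: order_integral oO Ox.
exact: order_integral oO' Oy.
Qed.

Lemma adj_int m (P : 'M[rat]_m) : (forall i j, P i j \is a Num.int) ->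
  forall i j, \adj P i j \is a Num.int.
Proof.
move=> Pint i j; rewrite mxE /cofactor rpredM //.
  by rewrite rpredX // rpredN rpred1.
by apply: det_int => k l; rewrite !mxE.
Qed.

Definition trace_dual b : set K := [set y | forall k : 'I_n,
  trK (y * b`_k) \is a Num.int].

(** The matrix [P] of traces between Z-bases of [O] and [O'] is integral, and its squared
    determinant is the product of the two absolute discriminants. Multiplying by the adjugate of [P]
    shows that [det P] times [y] lies in [O]; being a nonzero integer of size at most [B], [det P]
    divides [B!], which does not depend on [O]. *)
Lemma order_contains_dual O O' b (B : nat) y : is_order O -> is_order O' ->
  is_Zbasis O' b -> abs_disc O * abs_disc O' <= B%:R ->
  trace_dual b y -> O ((B`!)%:R *: y).
Proof.
move=> oO oO' O'b leB ydual; have [[c Oc] _ _] := oO.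
have bb : basis_of {:K} b by case: O'b.
have cc : basis_of {:K} c by case: Oc.
pose P : 'M[rat]_n := \matrix_(i, k) trK (c`_i * b`_k).
have Pint i k : P i k \is a Num.int.
  by rewrite mxE; apply: (trK_order_int oO oO');
    [exact: Zbasis_nth Oc|exact: Zbasis_nth O'b].
have PE : P = basis_mx b c *m gram b.
  apply/matrixP => i k; rewrite !mxE (basis_mxE c i bb) mulr_suml linear_sum.
  by apply: eq_bigr => l _; rewrite !mxE -scalerAl linearZ /= !(tnth_nth 0).
have detP2 : `|\det P| ^+ 2 = abs_disc O * abs_disc O'.
  rewrite (abs_discE Oc) (abs_discE O'b) (basis_disc_change (fun i => basis_mxE
    c i bb)).
  rewrite -!normrX -normrM PE det_mulmx -/(gram b) /basis_disc -/(gram b).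
  by rewrite exprMn [in LHS](expr2 (\det (gram b))) mulrA.
have dP0 : \det P != 0.
  have : `|\det P| ^+ 2 != 0.
    by rewrite detP2 mulf_neq0 // gt_eqF // abs_disc_gt0 //; [exists c|exists b].
  by rewrite sqrf_eq0 normr_eq0.
have /intrP[d dE] := det_int Pint.
have d0 : d != 0 by apply: contraNneq dP0 => d0; rewrite dE d0.
have dB : (`|d| <= B)%N.
  rewrite -(ler_nat rat); apply: le_trans leB;
    rewrite -detP2 dE -intr_norm -abszE.
  by rewrite -pmulrn -natrX ler_nat -[X in (X <= _)%N]expn1 leq_pexp2l //
    absz_gt0.
have dvd : (`|d| %| B`!)%N by rewrite dvdn_fact // absz_gt0 d0.
have coordE : \row_i coord c i y *m P = \row_k trK (y * b`_k).
  apply/rowP => k; rewrite !mxE [in RHS](coord_basis cc (memvf y)) mulr_suml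
    linear_sum.
  by apply: eq_bigr => i _; rewrite !mxE -scalerAl linearZ.
have dcoord i : d%:~R * coord c i y \is a Num.int.
  have := congr1 (fun M : 'rV_n => (M *m \adj P) 0 i) coordE.
  rewrite -mulmxA mul_mx_adj mul_mx_scalar -dE mxE [X in _ * X]mxE => ->.
  rewrite mxE rpred_sum // => k _; rewrite rpredM ?adj_int //.
  by rewrite mxE; exact: ydual.
apply/(Zbasis_mem _ Oc) => i; rewrite linearZ /=.
have /dvdnP[q ->] := dvd.
rewrite natrM -mulrA rpredM ?natr_int //.
have -> : (`|d|%N)%:R = (sgz d)%:~R * d%:~R :> rat
  by rewrite pmulrn -intrM -abszEsg.
by rewrite -mulrA rpredM ?intr_int.
Qed.

Lemma trace_form_surj b (z : 'I_n -> rat) : basis_of {:K} b ->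
  exists y, forall k : 'I_n, trK (y * b`_k) = z k.
Proof.
move=> bb; have G1 : gram b \in unitmx.
  by rewrite unitmxE unitfE; exact: basis_disc_neq0.
pose u := \row_k z k *m invmx (gram b).
exists (\sum_(i < n) u 0 i *: b`_i) => k.
have := congr1 (fun M : 'rV_n => M 0 k) (mulmxKV G1 (\row_k z k)).
rewrite -/u !mxE => <-; rewrite mulr_suml linear_sum; apply: eq_bigr => i _.
by rewrite !mxE !(tnth_nth 0) -scalerAl linearZ.
Qed.

Lemma lattice_add L x y : full_rank_lattice L -> L x -> L y -> L (x + y).
Proof.
move=> [b Lb] /(Zbasis_mem _ Lb) xL /(Zbasis_mem _ Lb) yL.
by apply/(Zbasis_mem _ Lb) => k; rewrite linearD; exact: (rpredD (xL k) (yL k)).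
Qed.

Lemma lattice_sub L x y : full_rank_lattice L -> L x -> L y -> L (x - y).
Proof.
move=> [b Lb] /(Zbasis_mem _ Lb) xL /(Zbasis_mem _ Lb) yL.
by apply/(Zbasis_mem _ Lb) => k; rewrite linearB; exact: (rpredB (xL k) (yL k)).
Qed.

(* All orders of discriminant at most [N] lie between [M D] and [D], where [D]
   is the trace dual of a fixed order and [M] only depends on [N]. *)
Lemma finite_bounded_disc (N : rat) :
  finite_set [set O : set K | is_order O /\ abs_disc O <= N].
Proof.
set A := [set O | _].
have [[U0 oU0]|no] := pselect (exists O : set K, is_order O); last first.
  suff -> : A = set0 by exact: finite_set0.
  by apply/seteqP; split => // O [oO _]; apply: no; exists O.
have [[b U0b] _ _] := oU0; have bb : basis_of {:K} b by case: U0b.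
have disc0 : 0 < abs_disc U0 by apply: abs_disc_gt0; exists b.
pose B := Num.bound `|N * abs_disc U0|; pose M := B`!.
have dualA O y : A O -> trace_dual b y -> O (M%:R *: y).
  move=> [oO ON]; apply: (order_contains_dual oO oU0 U0b).
  apply: (@le_trans _ _ (N * abs_disc U0)); first by rewrite ler_wpM2r // ltW.
  by apply: le_trans (ler_norm _) _; exact: ltW (archi_boundP (normr_ge0 _)).
(* [S O] is the image of [O] in [D / M D], where [D] is identified with integer vectors through
   traces against [b]. As [M D] lies in [O], this finite datum determines [O]. *)
pose S (O : set K) : {set {ffun 'I_n -> 'I_M}} :=
  [set w : {ffun 'I_n -> 'I_M} | `[< exists2 x, O x & forall k : 'I_n,
    trK (x * b`_k) = (w k)%:R >]]%SET.
have SS O O' : A O -> A O' -> S O = S O' -> O `<=` O'.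
  move=> AO AO' SOO' x Ox; have [oO _] := AO; have [oO' _] := AO'.
  have xint (k : 'I_n) : trK (x * b`_k) \is a Num.int.
    by apply: (trK_order_int oO oU0) => //; exact: Zbasis_nth U0b.
  pose m (k : 'I_n) := Num.floor (trK (x * b`_k)).
  have mE k : (m k)%:~R = trK (x * b`_k) by rewrite floorK.
  have Mi : (M : int) != 0 by rewrite -lt0n fact_gt0.
  have wlt k : (absz (m k %% M)%Z < M)%N.
    by rewrite -ltz_nat gez0_abs ?modz_ge0 // ltz_pmod // ltz_nat fact_gt0.
  pose w := [ffun k => Ordinal (wlt k)].
  have wE k : (w k)%:R = (m k %% M)%Z%:~R :> rat.
    by rewrite ffunE /= pmulrn gez0_abs ?modz_ge0.
  (* The traces of [y] are the quotients by [M], so [x - M y] is an element of [O] whose traces are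
     the remainders. *)
  have [y yE] := trace_form_surj (fun k => (m k %/ M)%Z%:~R) bb.
  have ydual : trace_dual b y by move=> k; rewrite yE intr_int.
  have trx' (k : 'I_n) : trK ((x - M%:R *: y) * b`_k) = (w k)%:R.
    rewrite mulrBl linearB /= -scalerAl linearZ /= yE wE -mE {1}(divz_eq (m k) M).
    by rewrite intrD intrM -pmulrn [_ *: _]mulrC addrAC subrr add0r.
  have : w \in S O.
    rewrite inE; apply/asboolP; exists (x - M%:R *: y) => //.
    by case: oO => latO _ _; apply: lattice_sub => //; exact: dualA.
  rewrite SOO' inE => /asboolP[x'' O'x'' trx''].
  have e : x'' = x - M%:R *: y.
    apply/eqP; rewrite -subr_eq0; apply/eqP; apply: (trK_nondegenerate bb) => k.
    by rewrite mulrBl linearB /= trx'' trx' subrr.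
  rewrite -[x](subrK (M%:R *: y)) -e.
  by case: oO' => latO' _ _; apply: lattice_add => //; exact: dualA.
apply: (@sub_finite_set _ _ ((fun t => xget set0 [set O | A O /\ S O =
  t]) @` [set: _])).
  move=> O AO; exists (S O) => //; case: xgetP => [U _ [AU SOU]|/(_ O) []//].
  by apply/seteqP; split; apply: SS.
by apply: finite_image; exact: finite_finset.
Qed.

End Bounded.

(** * Invariance under isomorphism *)

Section Isomorphism.
Variable K : fieldExtType rat.
Local Notation n := (\dim {:K}).
Implicit Types (L O : set K) (b c : n.-tuple K).

(** A Z-basis of [O] is a Q-basis of [K], so the values of [f] on it define a linear map, which
    agrees with [f] on [O] by additivity. It is multiplicative because it is so on pairs of basis
    elements, and injective because [K] is a field and [g 1 = 1]. *)
Lemma order_iso_extend O O' : is_order O -> order_iso O O' ->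
  exists g : 'End(K), [/\ lker g == 0%VS, g 1 = 1,
    forall u v, g (u * v) = g u * g v & O' = g @` O].
Proof.
move=> [[b Ob] one mulO] [f [fbij f1 fD fM]].
have bb : basis_of {:K} b by case: Ob.
have latO : full_rank_lattice O by exists b.
have zero : O 0 by apply/(Zbasis_mem _ Ob) => k; rewrite linear0.
have f0 : f 0 = 0 by apply: (@addrI _ (f 0)); rewrite -fD // !addr0.
have fB x y : O x -> O y -> f (x - y) = f x - f y.
  move=> Ox Oy; apply: (@addIr _ (f y)); rewrite -fD ?subrK //.
  exact: lattice_sub.
have natO x k : O x -> O (x *+ k).
  by move=> Ox; elim: k => [|k IH]; rewrite ?mulr0n // mulrS; exact: lattice_add.
have intO x a : O x -> O (x *~ a).
  move=> Ox; case: a => k; first exact: natO.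
  by rewrite NegzE mulrNz -[- _]sub0r; apply: lattice_sub => //; exact: natO.
have fn x k : O x -> f (x *+ k) = f x *+ k.
  move=> Ox; elim: k => [|k IH]; first by rewrite !mulr0n.
  by rewrite !mulrS fD ?IH //; exact: natO.
have fz x a : O x -> f (x *~ a) = f x *~ a.
  move=> Ox; case: a => k; first exact: fn.
  rewrite NegzE !mulrNz -[- _]sub0r fB //; last exact: natO.
  by rewrite f0 sub0r fn.
pose G x := \sum_(k < n) coord b k x *: f b`_k.
have Glin : linear G.
  move=> a x y; rewrite scaler_sumr -big_split; apply: eq_bigr => k _ /=.
  by rewrite linearP scalerDl scalerA.
pose aG := GRing.isSemilinear.Build rat K K _ G (GRing.semilinear_linear Glin).
pose GL : {linear K -> K} := HB.pack G aG.
pose g : 'End(K) := linfun GL.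
have Gb (i : 'I_n) : G b`_i = f b`_i.
  rewrite /G (bigD1 i) //= coord_free ?(basis_free bb) // eqxx scale1r.
  rewrite big1 ?addr0 // => k ki.
  by rewrite coord_free ?(basis_free bb) // eq_sym (negPf ki) scale0r.
have bO (k : 'I_n) : O b`_k by exact: Zbasis_nth Ob.
have gf x : O x -> g x = f x.
  have -> : O = [set x | inIntSpan b x] by case: Ob.
  case=> a ->; rewrite lfunE.
  have step (r : seq 'I_n) : O (\sum_(i <- r) b`_i *~ a i) /\
      GL (\sum_(i <- r) b`_i *~ a i) = f (\sum_(i <- r) b`_i *~ a i).
    elim: r => [|i r [Or IH]]; first by rewrite !big_nil linear0 f0.
    rewrite !big_cons; have Oi := intO _ (a i) (bO i); split.
      exact: lattice_add.
    by rewrite fD // linearD IH raddfMz fz //= Gb.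
  by have [_] := step (index_enum 'I_n).
have gM u v : g (u * v) = g u * g v.
  rewrite (coord_basis bb (memvf u)) (coord_basis bb (memvf v)).
  rewrite mulr_suml !linear_sum mulr_suml; apply: eq_bigr => i _.
  rewrite mulr_sumr !linear_sum mulr_sumr; apply: eq_bigr => j _.
  rewrite -scalerAl -scalerAr !linearZ /= -scalerAl -scalerAr;
    congr (_ *: (_ *: _)).
  have bbO : O (b`_i * b`_j) by apply: mulO; exact: bO.
  by rewrite (gf _ bbO) (gf _ (bO i)) (gf _ (bO j)) (fM _ _ (bO i) (bO j)).
have g1 : g 1 = 1 by rewrite gf.
exists g; split => //.
  rewrite -subv0; apply/subvP => u; rewrite memv_ker memv0 => /eqP gu.
  apply/negP => /negP u0; have := oner_neq0 K.
  by rewrite -g1 -(divff u0) gM gu mul0r eqxx.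
have -> : O' = f @` O by apply/seteqP; split;
  [case: fbij|case: fbij => h _ _ y [x Ox <-]; exact: h].
by apply/seteqP; split => y [x Ox <-]; exists x => //; rewrite gf.
Qed.

Variables (g : 'End(K)) (O : set K).
Hypotheses (g0 : lker g == 0%VS) (g1 : g 1 = 1).
Hypothesis gM : forall u v, g (u * v) = g u * g v.

Lemma limg_lker0 : limg g = {:K}%VS.
Proof. exact: lker0_limgf. Qed.

Lemma abs_disc_image : full_rank_lattice O -> abs_disc (g @` O) = abs_disc O.
Proof.
move=> [b Ob]; have bb : basis_of {:K} b by case: Ob.
have gOb : is_Zbasis (g @` O) (map_tuple g b).
  split.
    have cap0 : ({:K} :&: lker g)%VS = 0%VS by rewrite (eqP g0) capv0.
    by have := limg_basis_of cap0 bb; rewrite limg_lker0.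
  have nthg (i : 'I_n) : (map_tuple g b)`_i = g b`_i.
    by rewrite (nth_map 0) // size_tuple.
  apply/seteqP; split => y.
    case: (Ob) => _ -> [x [a ->] <-]; exists a; rewrite linear_sum.
    by apply: eq_bigr => i _; rewrite raddfMz nthg.
  case=> a ->; exists (\sum_(i < n) b`_i *~ a i); first by case: (Ob) => _ ->;
    exists a.
  by rewrite linear_sum; apply: eq_bigr => i _; rewrite raddfMz nthg.
rewrite (abs_discE gOb) (abs_discE Ob); congr (`|\det _|).
by apply/matrixP => i j; rewrite !mxE !tnth_map -gM trK_lrmorph.
Qed.

Lemma Knorm_image (R : realType) x : Knorm R (g x) = Knorm R x.
Proof.
have gB : zmod_morphism g by exact: linearB.
have gMM : monoid_morphism g by split.
pose h : {rmorphism K -> K} := HB.pack (g : K -> K)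
  (GRing.isZmodMorphism.Build K K g gB) (GRing.isMonoidMorphism.Build K K g gMM).
apply: (Knorm_rmorph R (g := h)) => y.
have /memv_imgP[z _ ->] : y \in limg g by rewrite limg_lker0 memvf.
by exists z.
Qed.

Lemma dim_Qspan_image (A : set K) : \dim (Qspan (g @` A)) = \dim (Qspan A).
Proof.
rewrite -[RHS](limg_dim_eq (f := g)) ?(eqP g0) ?capv0 //; congr (\dim _).
apply/eqP; rewrite eqEsubv; apply/andP; split.
  by apply: Qspan_sub => _ [x Ax <-]; apply: memv_img; exact: mem_Qspan.
apply/subvP => _ /memv_imgP[x xA ->]; rewrite memv_preim; apply: (subvP _ _ xA).
by apply: Qspan_sub => y Ay; rewrite -memv_preim; apply: mem_Qspan; exists y.
Qed.

Lemma succ_min_image (R : realType) i : succ_min R (g @` O) i = succ_min R O i.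
Proof.
rewrite /succ_min; congr minimum; apply/seteqP.
have e r : [set x | (g @` O) x /\ Knorm R x <= r] =
  g @` [set x | O x /\ Knorm R x <= r].
  apply/seteqP; split => [_ [[x Ox <-] xr]|_ [x [Ox xr] <-]].
    by exists x => //; split => //; rewrite -Knorm_image.
  by split; [exists x|rewrite Knorm_image].
by split => r /=; rewrite e dim_Qspan_image.
Qed.

End Isomorphism.

Lemma order_iso_invariants (R : realType) (K : fieldExtType rat) (O O' : set K) :
  is_order O -> order_iso O O' ->
  abs_disc O' = abs_disc O /\ forall i, succ_min R O' i = succ_min R O i.
Proof.
move=> oO /(order_iso_extend oO)[g [g0 g1 gM ->]]; split => [|i].
  by apply: abs_disc_image => //; case: oO.
exact: succ_min_image.
Qed.

(** * Orders adapted to a subfield *)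

Lemma Fadjoin_power_sum (K : fieldExtType rat) (E : {subfield K}) x v :
  v \in <<E; x>>%VS -> exists c : nat -> K,
    (forall k, c k \in E) /\ v = \sum_(k < adjoin_degree E x) c k * x ^+ k.
Proof.
move=> vE; exists (fun k => (Fadjoin_poly E x v)`_k); split=> [k|].
  exact: (polyOverP (Fadjoin_polyOver E x v)).
by rewrite -[LHS](Fadjoin_poly_eq vE) (horner_coef_wide _ (size_Fadjoin_poly _
  _ _)).
Qed.

Section AdaptedBasis.
Variable K : fieldExtType rat.
Local Notation n := (\dim {:K}).
Variable F : {subfield K}.
Local Notation m := (\dim F).

(* The basis consists of the products [a ^+ k * b ^+ l] with [K = F(a)] and
   [F = Q(b)], at position [k * m + l]. *)
Lemma adapted_basis : exists e : n.-tuple K,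
  [/\ basis_of {:K} e, e`_0 = 1
    & forall s t u : 'I_n, (s %/ m + t %/ m < u %/ m)%N ->
        coord e u (e`_s * e`_t) = 0].
Proof.
have m0 : (0 < m)%N := adim_gt0 F.
have [a _ gen_a] := primitive_element {:K}%AS.
have [b bF gen_b] := primitive_element F.
have full : <<F; a>>%VS = {:K}%VS :> {vspace K}.
  apply/eqP; rewrite eqEsubv subvf -gen_a /=; apply/FadjoinP; split.
    by rewrite sub1v.
  exact: memv_adjoin.
set d := adjoin_degree F a.
have nE : n = (d * m)%N by rewrite -full dim_Fadjoin.
have bE : adjoin_degree 1 b = m.
  by have := dim_Fadjoin 1 b; rewrite gen_b dimv1 muln1 => ->.
pose f k := a ^+ (k %/ m) * b ^+ (k %% m).
pose e := [tuple f i | i < n].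
have eE (i : 'I_n) : e`_i = f i by rewrite -tnth_nth tnth_mktuple.
have idx (k : 'I_d) (l : 'I_m) : (k * m + l < n)%N.
  rewrite nE; apply: (@leq_trans (k.+1 * m));
    last by rewrite leq_mul2r ltn_ord orbT.
  by rewrite mulSn addnC ltn_add2r.
have fE (k l : nat) : (l < m)%N -> f (k * m + l)%N = a ^+ k * b ^+ l.
  by move=> lm; rewrite /f divnMDl // divn_small // addn0 modnMDl modn_small.
have Fsum c : c \in F -> exists q : nat -> rat, c = \sum_(l < m) q l *: b ^+ l.
  move=> cF; have : c \in <<1; b>>%VS by rewrite gen_b.
  move=> /Fadjoin_power_sum[q' [q'1 ->]].
  have /choice[q qE] k : exists z : rat, q' k = z *: 1.
    by have /vlineP[z ->] := q'1 k; exists z.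
  by exists q; rewrite bE; apply: eq_bigr => l _; rewrite qE mulr_algl.
have lvl_sum (k : 'I_d) c : c \in F -> exists q : nat -> rat,
    c * a ^+ k = \sum_(l < m) q l *: e`_(Ordinal (idx k l)).
  move=> /Fsum[q ->]; exists q; rewrite mulr_suml; apply: eq_bigr => l _.
  by rewrite eE fE // -scalerAl mulrC.
have ebasis : basis_of {:K} e.
  rewrite basisEdim size_tuple leqnn andbT; apply/subvP => v _.
  have : v \in <<F; a>>%VS by rewrite full memvf.
  move=> /Fadjoin_power_sum[c [cF ->]]; apply: rpred_sum => k _.
  have [q ->] := lvl_sum k _ (cF k).
  apply: rpred_sum => l _; apply: rpredZ; apply: memv_span.
  by apply: mem_nth; rewrite size_tuple ltn_ord.
clearbody e; exists e; split => //.
  have n0 : (0 < n)%N := adim_gt0 {:K}%AS.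
  by rewrite (eE (Ordinal n0)) /f div0n mod0n mulr1.
(* The level of [u] keeps the exponent of [a] in the product below [d]. The product is then an
   element of [F] times one power of [a], so it involves only basis vectors of level
   [s %/ m + t %/ m], below that of [u]. *)
move=> s t u lt_u; have ltd : (s %/ m + t %/ m < d)%N.
  by apply: leq_trans lt_u _; rewrite -ltnS ltnS ltnW // ltn_divLR // -nE.
rewrite !eE /f mulrACA -exprD mulrC.
have cF : b ^+ (s %% m) * b ^+ (t %% m) \in F by rewrite -exprD rpredX.
have [q /= ->] := lvl_sum (Ordinal ltd) _ cF.
rewrite linear_sum big1 // => l _.
pose j := Ordinal (idx (Ordinal ltd) l).
have cj : coord e u e`_j = (u == j)%:R
  by rewrite coord_free ?(basis_free ebasis) // eq_sym.
rewrite linearZ /= cj; case: eqP => [uj|_]; last exact: mulr0.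
by move: lt_u; rewrite uj /= divnMDl // (divn_small (ltn_ord l)) addn0 ltnn.
Qed.
End AdaptedBasis.

Lemma common_denominator (I : finType) (q : I -> rat) :
  exists2 D : nat, (0 < D)%N & forall i, D%:R * q i \is a Num.int.
Proof.
exists (\prod_i absz (denq (q i))).
  by rewrite prodn_gt0 // => i; rewrite absz_gt0 denq_neq0.
move=> i; rewrite (bigD1 i) //= natrM mulrAC rpredM ?natr_int //.
rewrite pmulrn absz_denq mulrC -{1}[q i]divq_num_den.
by rewrite mulfVK ?intr_int // intr_eq0 denq_neq0.
Qed.

Section Family.
Variables (R : realType) (K : fieldExtType rat).
Local Notation n := (\dim {:K}).
Variable F : {subfield K}.
Local Notation m := (\dim F).

(** The adapted basis is scaled by [g N t], of the order of [N ^ (t %/ m)]. The change of basis is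
    diagonal, which gives the discriminant; coordinates in [e] of a lattice vector are multiples of
    the [g N t], which bounds the minima below; the first [k + 1] scaled vectors bound them
    above. *)
Lemma order_family : exists (O_ : nat -> set K) (C : rat) (c1 c2 : R),
  [/\ 0 < C, 0 < c1, 0 < c2 & forall N, (0 < N)%N ->
   [/\ is_order (O_ N), abs_disc (O_ N) = C * N%:R ^+ (2 * \sum_(t < n) t %/ m)
     & forall k, (k < n)%N -> c1 * N%:R ^+ (k %/ m) <= succ_min R (O_ N) k <=
                              c2 * N%:R ^+ (k %/ m)]].
Proof.
have n0 : (0 < n)%N := adim_gt0 {:K}%AS.
have m0 : (0 < m)%N := adim_gt0 F.
have [e [ee e0 eM]] := adapted_basis F.
have [D D0 Dint] := common_denominator
  (fun x : 'I_n * 'I_n * 'I_n => coord e x.2 (e`_x.1.1 * e`_x.1.2)).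
(* [D] clears the denominators of the structure constants of [e]; index [0] stays unscaled so that
   [1] belongs to the order. *)
pose h (t : nat) := if t == 0%N then 1%N else D.
pose g N t := (h t * N ^ (t %/ m))%N.
pose b N := [tuple (g N i)%:R *: e`_i | i < n].
have bE N (i : 'I_n) : (b N)`_i = (g N i)%:R *: e`_i.
  by rewrite -tnth_nth tnth_mktuple.
clearbody b.
have h0 t : (0 < h t)%N by rewrite /h; case: eqP.
have hD t : (h t <= D)%N by rewrite /h; case: eqP.
have g0 N t : (0 < N)%N -> (0 < g N t)%N by move=> N0;
  rewrite muln_gt0 h0 expn_gt0 N0.
have gR N t : (0 < N)%N -> (g N t)%:R != 0 :> rat.
  by move=> N0; rewrite pnatr_eq0 -lt0n g0.
have bb N : (0 < N)%N -> basis_of {:K} (b N).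
  move=> N0; rewrite basisEdim size_tuple leqnn andbT; apply/subvP => x _.
  rewrite (coord_basis ee (memvf x)); apply: rpred_sum => i _; apply: rpredZ.
  rewrite -[e`_i](scalerK (gR N i N0)); apply: rpredZ.
  by rewrite -bE; apply: memv_span; rewrite mem_nth // size_tuple.
have coordb N (u : 'I_n) x : (0 < N)%N ->
  coord (b N) u x = (g N u)%:R^-1 * coord e u x.
  move=> N0; have fb := basis_free (bb N N0).
  rewrite {1}(coord_basis ee (memvf x)).
  rewrite -(coord_sum_free (fun u : 'I_n => (g N u)%:R^-1 * coord e u x) u fb).
  congr (coord _ _ _); apply: eq_bigr => i _.
  by rewrite bE scalerA mulrAC mulVf ?mul1r // gR.
pose O_ N := [set x | inIntSpan (b N) x].
have Ob N : (0 < N)%N -> is_Zbasis (O_ N) (b N) by move=> N0; split => //;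
  exact: bb.
have oO N : (0 < N)%N -> is_order (O_ N).
  move=> N0; have ON := Ob N N0.
  have b0 : (b N)`_0 = 1.
    by rewrite (bE N (Ordinal n0)) e0 /g /h /= div0n muln1 scale1r.
  split; [by exists (b N)|by rewrite -b0; exact: (Zbasis_nth (Ordinal n0) ON)|].
  have basic (s t : 'I_n) : O_ N ((b N)`_s * (b N)`_t).
    have [s0|s0] := eqVneq (s : nat) 0%N.
      by rewrite s0 b0 mul1r; exact: Zbasis_nth ON.
    have [t0|t0] := eqVneq (t : nat) 0%N.
      by rewrite t0 b0 mulr1; exact: Zbasis_nth ON.
    apply/(Zbasis_mem _ ON) => u; rewrite coordb // !bE.
    rewrite -scalerAl -scalerAr !linearZ /=.
    have [lt_u|le_u] := ltnP (s %/ m + t %/ m) (u %/ m).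
      by rewrite eM // !mulr0.
    (* Of the two factors [D] in [g N s * g N t], one clears the structure constant and the other,
       with the power of [N], absorbs [g N u]. *)
    have dvd : (g N u %| D * N ^ (s %/ m + t %/ m))%N.
      apply: dvdn_mul; last exact: dvdn_exp2l.
      by rewrite /h; case: eqP => // _; rewrite dvd1n.
    have /dvdnP[q qE] := dvd.
    have gg : (g N s * g N t = D * q * g N u)%N.
      rewrite -mulnA -qE /g /h (negPf s0) (negPf t0) expnD.
      by rewrite mulnACA -mulnA.
    rewrite -[X in _ * X]/((g N s)%:R * ((g N t)%:R * _)) (mulrA (g N s)%:R)
      -natrM gg.
    rewrite natrM -mulrA mulrCA mulKf ?gR // natrM mulrAC rpredM ?natr_int //.
    exact: (Dint (s, t, u)).
  move=> x y Ox Oy; have bbN := bb N N0.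
  rewrite (coord_basis bbN (memvf x)) (coord_basis bbN (memvf y)).
  apply/(Zbasis_mem _ ON) => u; rewrite mulr_suml linear_sum rpred_sum // => s _.
  rewrite mulr_sumr linear_sum rpred_sum // => t _ /=.
  rewrite -scalerAl -scalerAr !linearZ /= rpredM ?(proj1 (Zbasis_mem _ ON)) //.
  apply: rpredM; first exact: (proj1 (Zbasis_mem _ ON) Oy t).
  exact: (proj1 (Zbasis_mem _ ON) (basic s t) u).
have [c c0 cP] := coord_bound R e.
pose c2 : R := D%:R * (1 + \sum_(t < n) Knorm R e`_t).
have c20 : 0 < c2.
  rewrite mulr_gt0 ?ltr0n // ltr_wpDr // sumr_ge0 // => t _; exact: Knorm_ge0.
exists O_, (`|basis_disc e| * (\prod_(t < n) (h t)%:R) ^+ 2), c^-1, c2;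
  split => //.
- rewrite mulr_gt0 ?normr_gt0 ?basis_disc_neq0 // exprn_gt0 // prodr_gt0 // =>
  t _.
  by rewrite ltr0n.
- by rewrite invr_gt0.
move=> N N0; split; first exact: oO.
  rewrite (abs_discE (Ob N N0)).
  have bdiag (i : 'I_n) : (b N)`_i =
    \sum_(k < n) diag_mx (\row_k (g N k)%:R) i k *: e`_k.
    rewrite (bigD1 i) //= !mxE eqxx mulr1n bE big1 ?addr0 // => k ki.
    by rewrite !mxE eq_sym (negPf ki) mulr0n scale0r.
  rewrite (basis_disc_change bdiag) det_diag normrM mulrC -mulrA; congr (_ * _).
  rewrite normrX ger0_norm; last by rewrite prodr_ge0 // => k _; rewrite mxE.
  rewrite mulnC exprM -exprMn; congr (_ ^+ 2).
  under eq_bigr do rewrite mxE natrM natrX.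
  by rewrite big_split /= -expr_sum.
move=> k kn; have latO : full_rank_lattice (O_ N) by exists (b N); exact: Ob.
have [lam0 lamdim lammin] := succ_minP R latO kn.
have NR : 1 <= N%:R :> R by rewrite ler1n.
apply/andP; split.
  (* Below the bound, coordinates at positions from [k %/ m * m] on vanish, since a nonzero one is
     at least [N ^ (k %/ m)] in size. The span then has dimension at most [k %/ m * m <= k]. *)
  rewrite leNgt mulrC; apply/negP => lt_lam; move: lamdim;
    rewrite ltnNge => /negP; apply.
  apply: (@leq_trans (\dim <<take (k %/ m * m) e>>)); last first.
    rewrite (leq_trans (dim_span _)) // size_take size_tuple.
    by rewrite (leq_ltn_trans (leq_divM k m) kn) leq_divM.
  apply: dimvS; apply: Qspan_sub => x [Ox xr].
  rewrite (coord_basis ee (memvf x)); apply: rpred_sum => u _.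
  have [u_lt|u_ge] := ltnP u (k %/ m * m).
    apply: rpredZ; apply: memv_span; rewrite -(nth_take 0 u_lt) mem_nth //.
    by rewrite size_take size_tuple; case: ifP.
  suff -> : coord e u x = 0 by rewrite scale0r mem0v.
  have /intrP[z zE] := proj1 (Zbasis_mem _ (Ob N N0)) Ox u.
  have eu : coord e u x = (g N u)%:R * z%:~R.
    by rewrite -zE coordb // mulrA divff ?mul1r // gR.
  have [z0|z0] := eqVneq z 0; first by rewrite eu z0 mulr0.
  have : (g N u)%:R <= `|ratr (coord e u x)| :> R.
    have -> : ratr (coord e u x) = (g N u)%:R * z%:~R :> R.
      rewrite eu; apply: etrans (rmorphM _ _ _) _.
      by congr (_ * _); [exact: ratr_nat|exact: ratr_int].
    rewrite normrM normr_nat ler_peMr //.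
    by rewrite -intr_norm -[1]/(1%:~R) ler_int -gtz0_ge1 normr_gt0.
  move=> /le_trans /(_ (cP u x)) le1.
  have : c * Knorm R x < N%:R ^+ (k %/ m).
    by rewrite -ltr_pdivlMl // mulrC (le_lt_trans xr).
  rewrite ltNge => /negP[]; apply: le_trans le1.
  apply: (@le_trans _ _ (N%:R ^+ (u %/ m))).
    by apply: ler_weXn2l => //; rewrite leq_divRL.
  by rewrite -natrX ler_nat leq_pmull.
apply: lammin; first by rewrite mulr_gt0 // exprn_gt0 // ltr0n.
apply: (@leq_trans (\dim <<take k.+1 (b N)>>)).
  have : free (take k.+1 (b N)).
    by have := basis_free (bb N N0); rewrite -{1}(cat_take_drop k.+1 (b N)) =>
      /catl_free.
  by rewrite /free => /eqP ->; rewrite size_take size_tuple; case: ifP.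
apply: dimvS; apply/span_subvP => x /(nthP 0)[t].
rewrite size_take size_tuple => t_lt; have t_le : (t <= k)%N.
  by move: t_lt; case: ifP => // /negbT; rewrite -leqNgt => nk tn;
    rewrite -ltnS (leq_trans tn).
rewrite nth_take ?ltnS // => <-.
have tn := leq_ltn_trans t_le kn.
apply: mem_Qspan; split; first exact: (Zbasis_nth (Ordinal tn) (Ob N N0)).
rewrite (bE N (Ordinal tn)) KnormZ ratr_nat normr_nat /=.
rewrite /c2 mulrAC ler_pM ?ler0n ?Knorm_ge0 //.
  by rewrite -natrX -natrM ler_nat leq_mul ?hD // leq_pexp2l // leq_div2r.
rewrite (bigD1 (Ordinal tn)) //= addrCA lerDl addr_ge0 // sumr_ge0 // => l _.
exact: Knorm_ge0.
Qed.

End Family.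

(** * Minkowski types *)

Lemma crdE (R : realType) m (x : 'rV[R]_m) (o : 'I_m) : crd x o.+1 = x 0 o.
Proof. by rewrite /crd insubT //= => o_lt; congr (x 0 _); apply: val_inj. Qed.

Lemma ln_gt (R : realType) (a x : R) : expR a < x -> a < ln x.
Proof.
move=> ax; have x0 : 0 < x by apply: lt_trans ax; exact: expR_gt0.
by rewrite -ltr_expR lnK.
Qed.

Lemma dist_le_norms (R : realFieldType) (a b t l : R) :
  a + t <= l -> l <= b + t -> `|t - l| <= `|a| + `|b|.
Proof.
move=> atl lbt; have := ler_norm b; have := ler_norm (- a); rewrite normrN.
have := normr_ge0 a; have := normr_ge0 b.
by rewrite ler_norml => *; apply/andP; split; lra.
Qed.

Section Spectrum.
Variables (R : realType) (K : fieldExtType rat).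
Local Notation n := (\dim {:K}).
Implicit Types (O : set K) (S : set (set (set K))).

Lemma order_iso_refl O : order_iso O O.
Proof. by exists id; split => //; split => // x Ox; exists x. Qed.

(** This makes the filter behind [minkowski_type] proper: with bounded discriminants, the classes in
    [S] would come from finitely many orders. *)
Lemma disc_unbounded S (N : R) : S `<=` @order_classes K -> infinite_set S ->
  exists O, [/\ (\bigcup_(C in S) C) O, is_order O & N < ratr (abs_disc O)].
Proof.
move=> SK; apply: contra_notP => noO; pose M := Num.bound `|N|.
have NM : N <= M%:R by apply: le_trans (ler_norm _) (ltW (archi_boundP
  (normr_ge0 _))).
apply: (@sub_finite_set _ _
  ((@iso_class K) @` [set O | is_order O /\ abs_disc O <= M%:R])); last first.
  by apply: finite_image; exact: finite_bounded_disc.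
move=> C SC; have [U oU UE] := SK _ SC; exists U => //; split => //.
rewrite leNgt; apply/negP => MU; apply: noO; exists U; split => //.
  exists C => //; rewrite -UE.
  by split => //; exact: order_iso_refl.
by apply: le_lt_trans NM _; rewrite -(ratr_nat R) ltr_rat.
Qed.

Lemma minkowski_typeP S (x : 'rV[R]_n.-1) :
  minkowski_type S x <-> forall eps : R, 0 < eps -> exists N : R,
    forall O, (\bigcup_(C in S) C) O -> N < ratr (abs_disc O) ->
    forall k, `|x 0 k - log_minima R O 0 k| < eps.
Proof.
split=> [Sx eps eps0|Sx A /nbhs_ballP[eps /= eps0 epsA]].
  have [N _ NP] := Sx _ (nbhsx_ballx x eps eps0).
  by exists N => O SO NO k; have [_] := NP O NO SO; apply.
have [N NP] := Sx _ eps0; exists N => // O NO SO; apply: epsA; split => // k l.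
by rewrite ord1; exact: NP.
Qed.

Lemma crd_log_minima k : (0 < k < n)%N ->
  exists o : 'I_n.-1, (forall x : 'rV[R]_n.-1, crd x k = x 0 o) /\
    forall O, log_minima R O 0 o = log_disc O (succ_min R O k).
Proof.
case: k => // k; rewrite /= => kn; have k_lt : (k < n.-1)%N by case: (n) kn.
exists (Ordinal k_lt); split=> [x|U]; last by rewrite mxE.
exact: (crdE x (Ordinal k_lt)).
Qed.

Lemma spectrum_submultiplicative i j c : (0 < i)%N -> (0 < j)%N ->
  (i + j < n)%N -> 0 < c ->
  (forall O, is_order O ->
    succ_min R O (i + j) <= c * succ_min R O i * succ_min R O j) ->
  Spe (@order_classes K) `<=`
    [set x : 'rV[R]_n.-1 | crd x (i + j) <= crd x i + crd x j].
Proof.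
move=> i0 j0 ij c0 subm x [S [SK Sinf /minkowski_typeP Sx]] /=.
have i_lt : (i < n)%N := leq_ltn_trans (leq_addr _ _) ij.
have j_lt : (j < n)%N := leq_ltn_trans (leq_addl _ _) ij.
have [|oi [xi li]] := @crd_log_minima i; first by rewrite i0.
have [|oj [xj lj]] := @crd_log_minima j; first by rewrite j0.
have [|oij [xij lij]] := @crd_log_minima (i + j); first by rewrite ij addn_gt0 i0.
rewrite xi xj xij leNgt; apply/negP => lt_x.
(* A quarter of the gap: the three coordinates and the term [ln c / L] each cost less than [eps]. *)
pose eps := (x 0 oij - (x 0 oi + x 0 oj)) / 4.
have eps0 : 0 < eps by rewrite /eps; lra.
have [N NP] := Sx _ eps0.
(* For discriminants beyond [T], the logarithm [L] is positive and [|ln c| / L < eps]. *)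
pose T := expR (`|ln c| / eps + 1).
have [U [SU oU]] := disc_unbounded (Num.max N T) SK Sinf.
rewrite gt_max => /andP[NU TU].
have := NP U SU NU oi; have := NP U SU NU oj; have := NP U SU NU oij.
rewrite li lj lij /log_disc; set L := ln (ratr _).
have LT : `|ln c| / eps + 1 < L by exact: ln_gt.
have q0 : 0 <= `|ln c| / eps by rewrite divr_ge0 // ltW.
have L0 : 0 < L by apply: lt_trans LT; rewrite ltr_wpDl.
have cL : `|ln c| / L < eps.
  by rewrite ltr_pdivrMr // mulrC -ltr_pdivrMr //; lra.
have [latU _ _] := oU.
have [li0 _ _] := succ_minP R latU i_lt; have [lj0 _ _] := succ_minP R latU j_lt.
have [lij0 _ _] := succ_minP R latU ij.
have : ln (succ_min R U (i + j)) / L <=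
    ln c / L + ln (succ_min R U i) / L + ln (succ_min R U j) / L.
  rewrite -!mulrDl ler_pM2r ?invr_gt0 // -!lnM ?posrE ?mulr_gt0 //.
  by rewrite ler_ln ?posrE ?mulr_gt0 //; exact: subm.
have : ln c / L <= `|ln c| / L by rewrite ler_pM2r ?invr_gt0 // ler_norm.
rewrite !ltr_norml /eps in cL * => h1 h2 /andP[h3 h4] /andP[h5 h6] /andP[h7 h8].
move: (ln (succ_min R U i) / L) (ln (succ_min R U j) / L)
  (ln (succ_min R U (i + j)) / L) (ln c / L) (`|ln c| / L) cL h1 h2 h3 h4 h5 h6
    h7 h8 lt_x.
move: (x 0 oi) (x 0 oj) (x 0 oij) => *; lra.
Qed.

Lemma subfield_spectrum i j (F : {subfield K}) : (0 < i)%N -> (0 < j)%N ->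
  (i + j < n)%N ->
  (i %% \dim F + j %% \dim F <> (i + j) %% \dim F)%N ->
  exists2 x : 'rV[R]_n.-1,
    Spe (@order_classes K) x & crd x i + crd x j < crd x (i + j).
Proof.
set m := \dim F => i0 j0 ij noF; have m0 : (0 < m)%N := adim_gt0 F.
have i_lt : (i < n)%N := leq_ltn_trans (leq_addr _ _) ij.
have j_lt : (j < n)%N := leq_ltn_trans (leq_addl _ _) ij.
have [ O_ [C [c1 [c2 [C0 c10 c20 famP]]]]] := order_family R F.
rewrite -/m in famP; set D := (2 * _)%N in famP.
(* The remainders carry, which adds one to the quotient. *)
have divE : ((i + j) %/ m = (i %/ m + j %/ m).+1)%N.
  rewrite divnD //; case: leqP => [_|lt]; first by rewrite addn1.
  by case: noF; rewrite modnD // leqNgt lt /= mul0n subn0.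
have D0 : (0 < D)%N.
  by rewrite /D (bigD1 (Ordinal ij)) //= divE mulnDr addn_gt0 muln_gt0.
have oO N : is_order (O_ N.+1) by have [] := famP N.+1 (ltn0Sn _).
pose S := [set iso_class (O_ N.+1) | N in [set: nat]].
(* The minima grow like [N ^ (k %/ m)] and the discriminant like [N ^ D], so the limits are ratios
   of exponents; column [k] holds coordinate [k + 1]. *)
pose x : 'rV[R]_n.-1 := \row_k ((k.+1 %/ m)%:R / D%:R).
have xE k : (0 < k < n)%N -> crd x k = (k %/ m)%:R / D%:R.
  case: k => // k kn; have k_lt : (k < n.-1)%N by move: kn; case: (n).
  by rewrite [LHS](crdE x (Ordinal k_lt)) mxE.
exists x; last first.
  rewrite !xE ?i0 ?j0 ?i_lt ?j_lt ?ij ?addn_gt0 ?i0 // -mulrDl -natrD.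
  by rewrite ltr_pM2r ?invr_gt0 ?ltr0n // ltr_nat divE.
exists S; split.
- by move=> _ [N _ <-]; exists (O_ N.+1).
(* As [D] is positive, distinct [N] give distinct discriminants, an isomorphism invariant. *)
- have inj : injective (fun N => iso_class (O_ N.+1)).
    move=> N M /= NM.
    have : iso_class (O_ N.+1) (O_ M.+1).
      by rewrite NM; split; [exact: oO|exact: order_iso_refl].
    move=> [_ /(order_iso_invariants R (oO N))[+ _]].
    have [_ -> _] := famP N.+1 (ltn0Sn _); have [_ -> _] := famP M.+1 (ltn0Sn _).
    move/(mulfI (lt0r_neq0 C0))/eqP; rewrite -!natrX eqr_nat eqn_exp2r //.
    by move=> /eqP[].
  move=> Sfin; apply: infinite_nat.
  have -> : [set: nat] = (fun N => iso_class (O_ N.+1)) @^-1` S.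
    by apply/seteqP; split => // N _; exists N.
  by apply: finite_preimage => // N M _ _; exact: inj.
apply/minkowski_typeP => eps eps0.
(* [B] bounds, uniformly in [N], the distance between [q / D * L] and the logarithm of the minimum:
   [c1] and [c2] account for the minimum, and [C] for the discriminant, with weight [q / D <= n].
   Division by a large [L] then makes the error less than [eps]. *)
pose B := `|ln c1| + `|ln c2| + n%:R * `|ln (ratr C : R)|.
have B0 : 0 <= B by rewrite /B !addr_ge0 // mulr_ge0.
exists (expR (B / eps + 1)) => U [_ [N _ <-] [_ /(order_iso_invariants R (oO
  N))[dE lE]]].
move=> UT k; rewrite !mxE /log_disc lE; set L := ln (ratr _).
have {UT} LT : B / eps + 1 < L by exact: ln_gt.
have L0 : 0 < L by apply: lt_trans LT; rewrite ltr_wpDl // divr_ge0 // ltW.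
have kn : (k.+1 < n)%N by rewrite -ltn_predRL ltn_ord.
have [_ discE lamE] := famP N.+1 (ltn0Sn _).
have NR : 0 < N.+1%:R :> R by rewrite ltr0n.
have CR : 0 < ratr C :> R by rewrite ltr0q.
have LE : L = ln (ratr C) + D%:R * ln N.+1%:R.
  rewrite /L dE discE rmorphM rmorphXn /= ratr_nat lnM ?posrE ?exprn_gt0 //.
  by rewrite lnXn // mulr_natl.
set q := (k.+1 %/ m)%N; have /andP[lo hi] := lamE _ kn; rewrite -/q in lo hi.
have [lam0 _ _] : [/\ 0 < succ_min R (O_ N.+1) k.+1, true & true].
  by have [latO _ _] := oO N; have [] := succ_minP R latO kn.
have lo' : ln c1 + q%:R * ln N.+1%:R <= ln (succ_min R (O_ N.+1) k.+1).
  rewrite mulr_natl -lnXn // -lnM ?posrE ?exprn_gt0 // ler_ln ?posrE ?mulr_gt0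
    ?exprn_gt0 //.
have hi' : ln (succ_min R (O_ N.+1) k.+1) <= ln c2 + q%:R * ln N.+1%:R.
  rewrite mulr_natl -lnXn // -lnM ?posrE ?exprn_gt0 // ler_ln ?posrE ?mulr_gt0
    ?exprn_gt0 //.
move: lo' hi'; set lam := ln (succ_min _ _ _); set lN := ln N.+1%:R in LE *.
move=> lo' hi'.
have DR : 0 < D%:R :> R by rewrite ltr0n.
have qDn : q%:R / D%:R * `|ln (ratr C : R)| <= n%:R * `|ln (ratr C : R)|.
  rewrite ler_wpM2r // ler_pdivrMr // -natrM ler_nat.
  rewrite (leq_trans (leq_div _ _)) // (leq_trans (ltnW kn)) // leq_pmulr //.
have main : `|q%:R / D%:R * L - lam| <= B.
  have -> : q%:R / D%:R * L - lam = q%:R / D%:R * ln (ratr C) + (q%:R * lN - lam).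
    by rewrite LE mulrDr mulrA mulfVK ?gt_eqF // addrA.
  apply: le_trans (ler_normD _ _) _; rewrite /B addrC lerD //.
    exact: dist_le_norms.
  by rewrite normrM ger0_norm // divr_ge0.
have -> : q%:R / D%:R - lam / L = (q%:R / D%:R * L - lam) / L.
  by rewrite mulrBl mulfK // gt_eqF.
rewrite normrM normfV (gtr0_norm L0) ltr_pdivrMr //; apply: le_lt_trans main _.
rewrite mulrC -ltr_pdivrMr //; apply: lt_trans LT; by rewrite ltrDl ltr01.
Qed.

End Spectrum.

Theorem theorem1p21 (R : realType) (K : fieldExtType rat) (n i j : nat)
    (degK : \dim {:K} = n) (n_ge2 : (2 <= n)%N)
    (i_ge1 : (1 <= i)%N) (j_ge1 : (1 <= j)%N) (ij_ltn : (i + j < n)%N) :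
  [<-> Spe (@order_classes K) `<=`
         [set x : 'rV[R]_(\dim {:K}).-1 | crd x (i + j) <= crd x i + crd x j];
       exists2 c : R, 0 < c & forall O : set K, is_order O ->
         succ_min R O (i + j) <= c * succ_min R O i * succ_min R O j;
       forall O : set K, is_order O ->
         succ_min R O (i + j)
           <= Num.sqrt n%:R * succ_min R O i * succ_min R O j;
       ~ exists (m : nat) (F : {subfield K}),
           \dim F = m /\ (i %% m + j %% m <> (i + j) %% m)%N].
Proof.
move: ij_ltn; rewrite -degK => ij_ltn.
have sub14 : Spe (@order_classes K) `<=`
         [set x : 'rV[R]_(\dim {:K}).-1 | crd x (i + j) <= crd x i + crd x j] ->
    ~ exists (m : nat) (F : {subfield K}),
           \dim F = m /\ (i %% m + j %% m <> (i + j) %% m)%N.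
  move=> sub [_ [F [<-]]] /(subfield_spectrum R i_ge1 j_ge1 ij_ltn)[x Sx].
  by rewrite ltNge sub.
have sub43 : (~ exists (m : nat) (F : {subfield K}),
           \dim F = m /\ (i %% m + j %% m <> (i + j) %% m)%N) ->
    forall O : set K, is_order O ->
         succ_min R O (i + j)
           <= Num.sqrt (\dim {:K})%:R * succ_min R O i * succ_min R O j.
  move=> noF O oO; apply: succ_minM => // F; apply: contrapT => badF.
  by apply: noF; exists (\dim F), F.
have n0 : 0 < Num.sqrt (\dim {:K})%:R :> R
  by rewrite sqrtr_gt0 ltr0n (adim_gt0 {:K}%AS).
have sub21 : (exists2 c : R, 0 < c & forall O : set K, is_order O ->
         succ_min R O (i + j) <= c * succ_min R O i * succ_min R O j) ->
    Spe (@order_classes K) `<=`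
         [set x : 'rV[R]_(\dim {:K}).-1 | crd x (i + j) <= crd x i + crd x j].
  by case=> c c0; exact: spectrum_submultiplicative.
(* The implications at hand are (1) to (4), (4) to (3), (2) to (1), and (3) to (2) with
   [c = sqrt n]; [tfae] asks for the cycle in the listed order, so each goal composes some of
   them. *)
tfae.
- by move=> /sub14/sub43; exists (Num.sqrt (\dim {:K})%:R).
- by move=> /sub21/sub14/sub43.
- by move=> sub; apply/sub14/sub21; exists (Num.sqrt (\dim {:K})%:R).
- by move=> /sub43 sub; apply/sub21; exists (Num.sqrt (\dim {:K})%:R).
Qed.
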